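(* Let $P$ be a decomposable $d$-dimensional convex polytope with at most $d^2+\tfrac12 d$ edges. Then either $P$ is combinatorially equivalent to the simplicial prism $\Delta_{1,d-1}$ (and hence has exactly $d^2$ edges), or $d=4$ and $P$ is combinatorially equivalent to $\Delta_{2,2}$.
   Context: A convex polytope $P$ is decomposable if $P=Q+R$ (Minkowski sum) for convex bodies $Q,R$ neither of which is of the form $\lambda P+t$ with $\lambda>0$ and $t$ a vector. Two polytopes are combinatorially equivalent if their face lattices are isomorphic. $\Delta_{m,n}$ denotes the Minkowski sum of an $m$-dimensional simplex and an $n$-dimensional simplex lying in complementary subspaces; thus $\Delta_{1,d-1}$ is the sum of a line segment and a $(d-1)$-simplex, and $\Delta_{2,2}$ is the sum of two triangles in complementary planes of $\mathbb{R}^4$.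
   Formalization: Stated for d ≥ 3: for d = 2 the claim fails (triangle plus a generic segment is a decomposable pentagon with 5 = d²+d/2 edges), and for d ≤ 1 nothing is decomposable; the parenthetical consequence ''has exactly d² edges'' is not stated. *)

(* Defs.v *)
From HB Require Import structures.
From mathcomp Require Import all_boot all_order all_algebra.
From mathcomp Require Import all_classical all_reals all_analysis.
Set Implicit Arguments. Unset Strict Implicit. Unset Printing Implicit Defensive.
Import Order.TTheory GRing.Theory Num.Theory.
Import numFieldTopology.Exports numFieldNormedType.Exports.
Local Open Scope classical_set_scope.
Local Open Scope ring_scope.

Section Polytopes.
Variables (R : realType) (n : nat).
Notation V := 'rV[R]_n.

Definition dotv (a x : V) : R := \sum_(i < n) a 0 i * x 0 i.

Definition conv (s : seq V) : set V :=
  [set x | exists w : 'I_(size s) -> R,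
     (forall i, 0 <= w i) /\ \sum_i w i = 1 /\ x = \sum_i w i *: s`_(val i)].

Definition polytope (P : set V) : Prop :=
  exists s : seq V, s != [::] /\ P = conv s.

Definition convexb (A : set V) : Prop :=
  forall x y t, A x -> A y -> 0 <= t -> t <= 1 -> A (t *: x + (1 - t) *: y).

Definition convex_body (A : set V) : Prop :=
  A !=set0 /\ convexb A /\ compact A.

Definition minkowski (A B : set V) : set V :=
  [set x | exists a b, A a /\ B b /\ x = a + b].

Definition homothet (Q P : set V) : Prop :=
  exists (lam : R) (t : V), 0 < lam /\ Q = [set lam *: p + t | p in P].

Definition decomposable (P : set V) : Prop :=
  exists Q Rb : set V, convex_body Q /\ convex_body Rb /\
    P = minkowski Q Rb /\ ~ homothet Q P /\ ~ homothet Rb P.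

(* faces: intersections with supporting hyperplanes (a = 0 allowed, so the
   empty face and P itself are faces) *)
Definition face (P F : set V) : Prop :=
  exists (a : V) (b : R), (forall x, P x -> dotv a x <= b) /\
    F = P `&` [set x | dotv a x = b].

Definition aff_indep (s : seq V) : Prop :=
  match s with
  | [::] => False
  | x0 :: t => forall c : 'I_(size t) -> R,
      \sum_i c i *: (t`_(val i) - x0) = 0 -> forall i, c i = 0
  end.

Definition has_dim (S : set V) (k : nat) : Prop :=
  (exists s : seq V, size s = k.+1 /\ (forall x, x \in s -> S x) /\ aff_indep s) /\
  (forall s : seq V, (forall x, x \in s -> S x) -> aff_indep s -> (size s <= k.+1)%N).

Definition edge (P F : set V) : Prop := face P F /\ has_dim F 1.

Definition at_most_edges (P : set V) (N : nat) : Prop :=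
  forall (k : nat) (f : 'I_k -> set V), injective f -> (forall i, edge P (f i)) ->
    (k <= N)%N.

End Polytopes.

Definition comb_equiv (R : realType) (n m : nat) (P : set 'rV[R]_n) (Q : set 'rV[R]_m) : Prop :=
  exists f : set 'rV[R]_n -> set 'rV[R]_m,
    (forall F, face P F -> face Q (f F)) /\
    (forall G, face Q G -> exists F, face P F /\ f F = G) /\
    (forall F1 F2, face P F1 -> face P F2 -> (F1 `<=` F2 <-> f F1 `<=` f F2)).

(* Delta_{m,n}: sum of the m-simplex conv{0,e_1..e_m} and the n-simplex
   conv{0,e_{m+1},..,e_{m+n}} in complementary coordinate subspaces of R^(m+n) *)
Definition Delta (R : realType) (m k : nat) : set 'rV[R]_(m + k) :=
  minkowski (conv (0 :: [seq delta_mx 0 (lshift k i) | i : 'I_m]))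
            (conv (0 :: [seq delta_mx 0 (rshift m j) | j : 'I_k])).
Arguments Delta R : clear implicits.

(* Main.v *)
(* Write P = Q + R and split every vertex as x_i = q_i + r_i.  Along an edge, q_i - q_j is a
   multiple s (x_i - x_j).  Attach to vertex i the line of homotheties (s, t) with
   q_i = s x_i + t: adjacent vertices have meeting lines, and since no three vertices are collinear
   pairwise meeting lines are concurrent.  If all lines were concurrent, Q or R would be homothetic
   to P.  So the lines form a partial linear space containing the graph of P, in which every vertex
   has degree at least d; if c of the lines pass through one point, counting the neighbours outside
   this block gives at least c (d - c + 2) vertices when c <= d.  The bound on the number of edges
   gives at most 2 d + 1 vertices, with P simple in case of equality, which leaves c = 2, c = d,
   c > d, or c = 3 with d = 4.  Together with the fact that nonmeeting vertices of a simple polytope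
   have at most two common neighbours, this forces the graph of P to be the product of K_2 and K_d,
   or of two copies of K_3 with d = 4.  In both cases P is simple, its facets can be read off the
   graph, and its faces are the products of subsets of the two factors, as for Delta. *)
From mathcomp Require Import all_boot zify.
Set Implicit Arguments. Unset Strict Implicit. Unset Printing Implicit Defensive.

(** * Rook graphs *)

(** The geometry rests on [motzkin] and on its consequence [cone_nb]: at a vertex, the cone of [P]
    is generated by the edge directions. From it come the degree bound, connectedness, the facets of
    simple polytopes and, once the graph is known, all faces. The combinatorial part sees only the
    graph, the meeting relation and numerical bounds. The edge bound enters three times: through the
    number of vertices, through simplicity when there are [2 d + 1] of them, and for [d = 3] through
    parity, since 21 is odd and at most 6 vertices remain. Counting around one block says nothing
    about sizes 2 and above [d]; comparing blocks at neighbouring vertices then gives a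
    contradiction or exhibits a block of a settled size. *)

Definition rook_graph (I : finType) (adj : rel I) (p q : nat) : Prop :=
  exists (g1 : I -> 'I_p.+1) (g2 : I -> 'I_q.+1),
    [/\ injective (fun i => (g1 i, g2 i)), #|I| = p.+1 * q.+1 &
        forall i j, adj i j = (i != j) && ((g1 i == g1 j) || (g2 i == g2 j))].

Definition pos (I : finType) (X : {set I}) (m : nat) (x : I) : 'I_m.+1 :=
  inord (index x (enum X)).

Lemma pos_inj (I : finType) (X : {set I}) (m : nat) :
  #|X| = m.+1 -> {in X &, injective (pos X m)}.
Proof.
move=> cX x y xX yX /(congr1 val); rewrite /= !inordK -?cX ?cardE ?index_mem ?mem_enum //.
by move=> /(congr1 (nth x (enum X))); rewrite !nth_index ?mem_enum.
Qed.

Lemma leq_card_bigcup (T J : finType) (P : pred J) (F : J -> {set T}) :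
  #|\bigcup_(j | P j) F j| <= \sum_(j | P j) #|F j|.
Proof.
elim/big_rec2: _ => [|j m X _ le]; first by rewrite cards0.
by rewrite (leq_trans (leq_card_setU _ _)) ?leq_add2l.
Qed.

(* In the application, vertex [i] carries the line of all pairs [(s, t)] such that the homothety
   [y |-> s y + t] sends [x i] to its summand point [q i]; [mt s i j] says that the lines of [i]
   and [j] meet at height [s], and a block consists of the lines through one point. *)
Section RookGraphs.
Variables (S : eqType) (I : finType) (adj : rel I) (mt : S -> rel I) (d : nat).
Implicit Types (i j k u v w : I) (s t r : S) (X Y : {set I}).

Definition nb v : {set I} := [set k | adj v k].
Definition block s i : {set I} := [set k | mt s i k].

Hypothesis adjC : symmetric adj.
Hypothesis adj_irr : irreflexive adj.
Hypothesis mt_refl : forall s, reflexive (mt s).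
Hypothesis mtC : forall s, symmetric (mt s).
Hypothesis mt_trans : forall s, transitive (mt s).
Hypothesis mt_uniq : forall s t i j, i != j -> mt s i j -> mt t i j -> s = t.
Hypothesis adj_mt : forall i j, adj i j -> exists s, mt s i j.
Hypothesis mt_triangle : forall s t r i j k, i != j -> j != k -> i != k ->
  mt s i j -> mt t j k -> mt r i k -> s = t.
Hypothesis d_ge3 : 3 <= d.
Hypothesis deg_ge : forall v, d <= #|nb v|.
Hypothesis common_nb : forall v a, (forall s, ~~ mt s v a) ->
  #|nb v :&: nb a| + d <= #|nb v| + 2.
Hypothesis facet_nb : (forall v, #|nb v| = d) -> forall v w, adj v w ->
  exists F : {set I}, [/\ v \in F, w \notin F,
    forall k, adj v k -> k != w -> k \in F &
    forall u, u \in F -> #|nb u :\: F| = 1].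
Hypothesis card_le : #|I| <= 2 * d + 1.
Hypothesis regular : #|I| = 2 * d + 1 -> forall v, #|nb v| = d.
Hypothesis card_le6 : d = 3 -> #|I| <= 6.
Hypothesis two_blocks : exists v u w s, [/\ adj v u, adj v w, mt s v u & ~~ mt s v w].

Ltac card_lia := move: d_ge3 card_le;
  repeat match goal with |- context [card ?A] => move: (card A) end; clear; lia.

Lemma adj_neq i j : adj i j -> i != j.
Proof. by apply: contraTneq => ->; rewrite adj_irr. Qed.

Lemma mt_mid s i j k : mt s i j -> mt s i k -> mt s j k.
Proof. by rewrite mtC => ij ik; apply: mt_trans ij ik. Qed.

Lemma block_mt s i j k : j \in block s i -> k \in block s i -> mt s j k.
Proof. by rewrite !inE; apply: mt_mid. Qed.

Lemma block_mem s i j k : j \in block s i -> mt s j k -> k \in block s i.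
Proof. by rewrite !inE; apply: mt_trans. Qed.

(** The lines of [j], [k] and [w] meet pairwise, so they are concurrent, in the point that defines
    the block. Hence a vertex outside a block is adjacent to at most one of its members, which makes
    the sets [out] disjoint. *)
Lemma outside_block s i j k w t r : j \in block s i -> k \in block s i -> j != k ->
  mt t j w -> mt r k w -> w \in block s i.
Proof.
move=> jB kB jk tjw rkw.
have [->//|jw] := eqVneq w j; have [->//|kw] := eqVneq w k.
have sr : s = r by apply: (mt_triangle jk _ _ (block_mt jB kB) rkw tjw); rewrite eq_sym.
by apply: block_mem kB _; rewrite sr.
Qed.

Definition out X k : {set I} := nb k :\: X.

Lemma out_inj s i j k w : j \in block s i -> k \in block s i ->
  w \in out (block s i) j -> w \in out (block s i) k -> j = k.
Proof.
move=> jB kB; rewrite /out 2!in_setD => /andP[wB wj] /andP[_ wk].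
apply/eqP/negPn/negP => jk; move/negP: wB; apply.
rewrite inE in wj; rewrite inE in wk.
have [t tjw] := adj_mt wj; have [r rkw] := adj_mt wk.
exact: outside_block jB kB jk tjw rkw.
Qed.

Lemma sum_out_cover s i :
  \sum_(k in block s i) #|out (block s i) k| <= #|\bigcup_(k in block s i) out (block s i) k|.
Proof.
set B := block s i; set U := \bigcup_(k in B) _.
have E k : k \in B -> #|out B k| = \sum_(w in U) (w \in out B k).
  move=> kB; rewrite -sum1_card big_mkcond [RHS]big_mkcond; apply: eq_bigr => w _.
  case: (boolP (w \in out B k)) => wk; last by rewrite if_same.
  by rewrite (subsetP (bigcup_sup k kB) w wk).
rewrite (eq_bigr _ E) exchange_big -[leqRHS]sum1_card.
apply: leq_sum => w /bigcupP[j jB jw].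
rewrite (bigD1 j) //= big1 ?addn0 ?leq_b1 // => k /andP[kB].
by case: (boolP (w \in _)) => // kw /eqP[]; exact: out_inj kB jB kw jw.
Qed.

Lemma cover_out_sub s i : \bigcup_(k in block s i) out (block s i) k \subset ~: block s i.
Proof. by apply/bigcupsP => k _; apply/subsetP => w; rewrite in_setD in_setC => /andP[]. Qed.

Lemma card_out_sum s i :
  #|block s i| + \sum_(k in block s i) #|out (block s i) k| <= #|I|.
Proof.
rewrite -(cardsC (block s i)) leq_add2l (leq_trans (sum_out_cover s i)) //.
exact: subset_leq_card (cover_out_sub s i).
Qed.

Lemma card_nb_split s i k : k \in block s i ->
  #|nb k| = #|nb k :&: block s i| + #|out (block s i) k|.
Proof. by move=> kB; rewrite -(cardsID (block s i) (nb k)). Qed.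

Lemma nb_block_sub s i k : nb k :&: block s i \subset block s i :\ k.
Proof.
apply/subsetP=> w; rewrite !inE => /andP[kw ->]; rewrite andbT.
by rewrite eq_sym adj_neq.
Qed.

Lemma card_nb_block s i k : k \in block s i -> #|nb k :&: block s i| < #|block s i|.
Proof.
move=> kB; have /subset_leq_card := nb_block_sub s i k.
by rewrite [#|block s i|](cardsD1 k) kB.
Qed.

Lemma out_ge s i k : k \in block s i -> d < #|out (block s i) k| + #|block s i|.
Proof.
move=> kB; have := card_nb_block kB; have := deg_ge k; rewrite (card_nb_split kB); lia.
Qed.

Lemma block_self s i : i \in block s i.
Proof. by rewrite inE mt_refl. Qed.

Lemma block_card s i : #|block s i| <= d ->
  #|block s i| * (d.+2 - #|block s i|) <= #|I|.
Proof.
move=> c_le; have := card_out_sum s i.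
have : \sum_(k in block s i) (d.+1 - #|block s i|)
       <= \sum_(k in block s i) #|out (block s i) k|.
  by apply: leq_sum => k kB; have := out_ge kB; lia.
rewrite sum_nat_const; nia.
Qed.

Lemma block_card_cases s i : 2 <= #|block s i| ->
  [\/ #|block s i| = 2, #|block s i| = d, d < #|block s i| |
      [/\ d = 4, #|block s i| = 3 & #|I| = 9]].
Proof.
move=> c_ge2; have [dc|c_le] := ltnP d #|block s i|; first by constructor 3.
have H := block_card c_le.
have [c2|c2] := eqVneq #|block s i| 2; first by constructor 1.
have [cd|cd] := eqVneq #|block s i| d; first by constructor 2.
(* With [c] the size of the block, [c (d + 2 - c) = 2 d + (c - 2) (d - c)], and there are at most
   [2 d + 1] vertices. *)
have E : (#|block s i| - 2) * (d - #|block s i|) <= 1 by nia.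
have a_gt0 : 0 < #|block s i| - 2 by lia.
have b_gt0 : 0 < d - #|block s i| by lia.
have E1 := leq_trans (leq_pmulr (#|block s i| - 2) b_gt0) E.
have E2 := leq_trans (leq_pmull (d - #|block s i|) a_gt0) E.
have [c3 d4] : #|block s i| = 3 /\ d = 4 by lia.
constructor 4; split => //; by move: H card_le; rewrite c3 d4 /=; lia.
Qed.

(** * A block of size [d]: the graph of the prism *)

Section BlockOfSizeD.
Variables (s : S) (i : I).
Local Notation B := (block s i).
Hypothesis cB : #|B| = d.

Lemma out_gt0 k : k \in B -> 0 < #|out B k|.
Proof. by move=> /out_ge; rewrite cB; lia. Qed.

Lemma out_le1_adj k j : k \in B -> #|out B k| <= 1 -> j \in B -> j != k -> adj k j.
Proof.
move=> kB o1 jB jk; have := nb_block_sub s i k => sub.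
have : j \in nb k :&: B.
  have /eqP -> : nb k :&: B == B :\ k.
    rewrite eqEcard sub; have := deg_ge k; rewrite (card_nb_split kB).
    by have := cardsD1 k B; rewrite kB cB; lia.
  by rewrite !inE jk; rewrite inE in jB.
by rewrite !inE => /andP[].
Qed.

(** Two members with two outside neighbours would give more than [2 d + 1] vertices. If only [k] has
    two, every other member is adjacent to the whole block, so [k] has degree at least [d + 1]; but
    then there are [2 d + 1] vertices and the graph is regular of degree [d]. *)
Lemma out_eq1 k : k \in B -> #|out B k| = 1.
Proof.
move=> kB; apply/eqP; rewrite eqn_leq out_gt0 // andbT leqNgt; apply/negP => o2.
have sum_le := card_out_sum s i.
have rest1 j : j \in B -> j != k -> #|out B j| <= 1.
  move=> jB jk; rewrite leqNgt; apply/negP => oj2.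
  have : \sum_(l | (l \in B) && (l != k) && (l != j)) 1
         <= \sum_(l | (l \in B) && (l != k) && (l != j)) #|out B l|.
    by apply: leq_sum => l /andP[/andP[lB _] _]; exact: out_gt0.
  rewrite sum1_card; move: sum_le; rewrite (bigD1 k) //= (bigD1 j) ?jB //= cB.
  have -> : #|[pred l | (l \in B) && (l != k) && (l != j)]| = d - 2.
    have := cardsD1 k B; have := cardsD1 j (B :\ k); rewrite !in_setD1 jk jB kB cB /=.
    have -> : #|B :\ k :\ j| = #|[pred l | (l \in B) && (l != k) && (l != j)]|.
      by apply: eq_card => l; rewrite !inE andbC [_ && (l != k)]andbC.
    lia.
  by set X := (\sum_(_ | _) _)%N; move: o2 oj2; card_lia.
have kadj j : j \in B -> j != k -> adj k j.
  by move=> jB jk; rewrite adjC; apply: out_le1_adj (rest1 j jB jk) kB _; rewrite // eq_sym.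
have cnb : #|nb k :&: B| = d.-1.
  have -> : nb k :&: B = B :\ k.
    apply/eqP; rewrite eqEsubset nb_block_sub; apply/subsetP => j.
    rewrite in_setD1 => /andP[jk jB]; rewrite in_setI jB inE kadj //.
  by move: cB; rewrite (cardsD1 k) kB /= => <-.
have : \sum_(l in B | l != k) 1 <= \sum_(l in B | l != k) #|out B l|.
  by apply: leq_sum => l /andP[lB _]; exact: out_gt0.
rewrite sum1_card; move: sum_le; rewrite (bigD1 k) //= cB.
have -> : #|[pred l in B | l != k]| = d.-1.
  rewrite -[in RHS]cB (cardsD1 k B) kB /=; apply: eq_card => l; rewrite !inE; exact: andbC.
move=> le1 le2; have cI : #|I| = 2 * d + 1 by move: le1 le2 o2; card_lia.
by have := regular cI k; rewrite (card_nb_split kB) cnb; move: o2; card_lia.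
Qed.

Lemma adj_block k j : k \in B -> j \in B -> j != k -> adj k j.
Proof. by move=> kB jB; apply: out_le1_adj; rewrite // out_eq1. Qed.

Definition partner k : I := odflt k [pick w in out B k].

Lemma partnerP k : k \in B -> out B k = [set partner k].
Proof.
move=> /out_eq1/eqP/cards1P[w Ew]; rewrite /partner Ew.
by case: pickP => [y|/(_ w)]; rewrite in_set1 ?eqxx // => /eqP ->.
Qed.

Lemma adj_partner k : k \in B -> adj k (partner k).
Proof.
move=> /partnerP E; have : partner k \in out B k by rewrite E set11.
by rewrite !inE => /andP[].
Qed.

Lemma partner_notin k : k \in B -> partner k \notin B.
Proof.
move=> /partnerP E; have : partner k \in out B k by rewrite E set11.
by rewrite in_setD => /andP[].
Qed.

Lemma adj_out k w : k \in B -> w \notin B -> adj k w -> w = partner k.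
Proof.
move=> kB wB kw; apply/eqP; rewrite -in_set1 -partnerP // in_setD wB inE //.
Qed.

Lemma partner_inj : {in B &, injective partner}.
Proof.
move=> k j kB jB E; apply: (out_inj kB jB (w := partner k)).
  by rewrite partnerP ?set11.
by rewrite E partnerP ?set11.
Qed.

Definition opposite : {set I} := partner @: B.

Lemma card_opposite : #|opposite| = d.
Proof. by rewrite card_in_imset ?cB //; exact: partner_inj. Qed.

Lemma opposite_sub : opposite \subset ~: B.
Proof. by apply/subsetP => _ /imsetP[k kB ->]; rewrite in_setC partner_notin. Qed.

Lemma nb_partner k : k \in B -> nb (partner k) \subset k |: ~: B.
Proof.
move=> kB; apply/subsetP => w; rewrite in_setU1 in_setC inE => pw.
have [wB|] := boolP (w \in B); last by rewrite orbT.
rewrite orbF; apply/eqP/partner_inj => //.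
by apply/esym/adj_out; rewrite ?partner_notin // adjC.
Qed.

(* The extra vertex [z] would be joined to the whole opposite simplex; the facet at [z]
   avoiding [partner i] then has a vertex with no or two neighbours outside it. *)
Lemma card_neq : #|I| != 2 * d + 1.
Proof.
apply/eqP => cI; have reg := regular cI.
have cBC : #|~: B| = d.+1 by have := cardsC B; rewrite cB cI; lia.
have /eqP/cards1P[z Ez] : #|~: B :\: opposite| = 1.
  have := cardsID opposite (~: B).
  by rewrite (setIidPr opposite_sub) cBC card_opposite; lia.
have [zB zO] : z \notin B /\ z \notin opposite.
  have : z \in ~: B :\: opposite by rewrite Ez set11.
  by rewrite in_setD in_setC => /andP[-> ->].
have notB w : w \notin B -> w = z \/ w \in opposite.
  move=> wB; have [|wO] := boolP (w \in opposite); first by right.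
  by left; apply/set1P; rewrite -Ez in_setD wO in_setC.
have nbz : nb z = opposite.
  apply/eqP; rewrite eqEcard card_opposite reg leqnn andbT; apply/subsetP => w.
  rewrite inE => zw; have [wB|wB] := boolP (w \in B).
    by case/negP: zO; rewrite (adj_out wB zB) 1?adjC //; apply: imset_f.
  by case: (notB w wB) => // wz; rewrite wz adj_irr in zw.
have iB : i \in B by exact: block_self.
set p := partner; set p1 := p i.
have zadj k : k \in B -> adj z (p k).
  by move=> kB; have : p k \in nb z by [rewrite nbz; apply: imset_f]; rewrite inE.
have [F [zF p1F nbF outF]] := facet_nb reg (zadj i iB).
have pF k : k \in B -> k != i -> p k \in F.
  move=> kB ki; apply: nbF; first exact: zadj.
  by apply: contraNneq ki => /(partner_inj kB iB) ->.
have outF1 u w w' : u \in F -> adj u w -> adj u w' -> w \notin F -> w' \notin F -> w = w'.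
  move=> /outF/eqP/cards1P[y Ey] uw uw' wF w'F.
  have : w \in nb u :\: F by rewrite !inE wF.
  have : w' \in nb u :\: F by rewrite !inE w'F.
  by rewrite Ey => /set1P -> /set1P ->.
have outF2 u : u \in F -> exists2 w, adj u w & w \notin F.
  move=> /outF/eqP/cards1P[y Ey]; have : y \in nb u :\: F by rewrite Ey set11.
  by rewrite !inE => /andP[? ?]; exists y.
have nbp k w : k \in B -> adj (p k) w -> [\/ w = k, w = z | exists2 j, j \in B & w = p j].
  move=> kB pw; have /subsetP/(_ w) := nb_partner kB; rewrite inE => /(_ pw).
  rewrite in_setU1 in_setC => /orP[/eqP->|/notB[->|/imsetP[j jB ->]]].
  - by constructor 1.
  - by constructor 2.
  - by constructor 3; exists j.
(* The neighbours of [p k] are among [k], [z] and other partners. All of these except [p1] lie in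
   [F], so the neighbour that [p k] must have outside [F] is [p1]. *)
have key k : k \in B -> k != i -> k \in F -> adj (p k) p1.
  move=> kB ki kF; have [w pw wF] := outF2 _ (pF k kB ki).
  case: (nbp k w kB pw) => [E|E|[j jB E]]; rewrite E in wF pw.
  - by rewrite kF in wF.
  - by rewrite zF in wF.
  have [ji|/(pF _ jB)] := eqVneq j i; first by rewrite /p1 -ji.
  by move=> pj; rewrite pj in wF.
(* If [B] meets [F], uniqueness of the neighbour outside [F] puts all of [B] except possibly [i]
   into [F]. Then [p1] is adjacent to [i], [z] and the [d - 1] other partners, one neighbour too
   many. *)
have [/exists_inP[k kB kF]|/exists_inPn none] := boolP [exists k in B, k \in F].
  have allF j : j \in B -> j != i -> j \in F.
    move=> jB ji; apply: contraT => jF; have [iF|iF] := boolP (i \in F).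
      have E := outF1 i j p1 iF (adj_block iB jB ji) (adj_partner iB) jF p1F.
      by have := partner_notin iB; rewrite -/p -/p1 -E jB.
    case/eqP: ji; apply: (outF1 k) => //; apply: adj_block => //.
      by apply: contraNneq jF => ->.
    by apply: contraNneq iF => ->.
  have : [set i; z] :|: (p @: (B :\ i)) \subset nb p1.
    apply/subsetP => w /setUP[/set2P[]->|/imsetP[j]].
    - by rewrite inE adjC adj_partner.
    - by rewrite inE adjC zadj.
    by rewrite in_setD1 => /andP[ji jB] ->; rewrite inE adjC key ?allF.
  move=> /subset_leq_card; rewrite reg cardsU cards2 card_in_imset; last first.
    by move=> a b; rewrite !in_setD1 => /andP[_ aB] /andP[_ bB]; exact: partner_inj.
  have -> : [set i; z] :&: p @: (B :\ i) = set0.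
    apply/setP => w; rewrite in_setI in_set0; apply/negP => /andP[/set2P[]->].
      move=> /imsetP[l]; rewrite in_setD1 => /andP[_ lB] E.
      by have := partner_notin lB; rewrite -/p -E iB.
    move=> /imsetP[l]; rewrite in_setD1 => /andP[_ lB] E.
    by case/negP: zO; rewrite E; apply: imset_f.
  have -> : i != z by apply: contraNneq zB => <-.
  by rewrite cards0; have := cardsD1 i B; rewrite iB cB /=; lia.
(* No vertex of [B] lies in [F], so no partner other than [p1] is adjacent to [p1]. *)
have : nb p1 \subset [set i; z].
  apply/subsetP => w; rewrite inE => pw; rewrite in_set2.
  case: (nbp i w iB pw) => [->|->|[j jB E]]; rewrite ?eqxx ?orbT //.
  have [ji|ji] := eqVneq j i; first by rewrite E ji adj_irr in pw.
  have := outF1 (p j) p1 j (pF j jB ji); rewrite E adjC in pw.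
  move=> /(_ pw); rewrite adjC adj_partner // => /(_ isT p1F (none j jB)) E1.
  by have := partner_notin iB; rewrite -/p -/p1 E1 jB.
move=> /subset_leq_card; rewrite reg cards2; case: (i != z) => /=; lia.
Qed.

Lemma opposite_compl : ~: B = opposite.
Proof.
apply/esym/eqP; rewrite eqEcard opposite_sub card_opposite /=.
by have := cardsC B; rewrite cB; move: card_neq; card_lia.
Qed.

(** A vertex outside [B] can only be adjacent to one member of [B] and to the [d - 1] other outside
    vertices; the degree bound forces all of these. *)
Lemma adj_opposite x y : x \notin B -> y \notin B -> x != y -> adj x y.
Proof.
move=> xB yB xy; have : x \in opposite by rewrite -opposite_compl in_setC.
move=> /imsetP[k kB Ex].
have sub : nb x \subset k |: (~: B :\ x).
  apply/subsetP => w wx; have /subsetP/(_ w) := nb_partner kB; rewrite -Ex => /(_ wx).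
  rewrite !in_setU1 in_setD1 => /orP[->//|->]; rewrite andbT.
  by move: wx; rewrite inE => /adj_neq; rewrite [x == w]eq_sym => ->; rewrite orbT.
have E : nb x = k |: (~: B :\ x).
  apply/eqP; rewrite eqEcard sub (leq_trans _ (deg_ge x)) //.
  have -> : #|k |: (~: B :\ x)| = #|~: B :\ x|.+1.
    by rewrite cardsU1 in_setD1 in_setC kB andbF.
  have := cardsD1 x (~: B); rewrite in_setC xB.
  by rewrite [in #|~: B|]opposite_compl card_opposite /=; card_lia.
have : y \in nb x by rewrite E in_setU1 in_setD1 in_setC yB [y == x]eq_sym xy orbT.
by rewrite inE.
Qed.

(** Projection onto [B] along the matching [partner]. The default is never reached, because every
    vertex outside [B] is a partner. *)
Definition column x : I :=
  if x \in B then x else odflt x [pick k in B | partner k == x].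

Lemma column_in x : column x \in B.
Proof.
rewrite /column; case: ifPn => // xB; case: pickP => [k /andP[]//|none].
have : x \in opposite by rewrite -opposite_compl in_setC.
by move=> /imsetP[k kB Ex]; have := none k; rewrite kB Ex eqxx.
Qed.

Lemma partner_column x : x \notin B -> partner (column x) = x.
Proof.
move=> xB; rewrite /column (negPf xB); case: pickP => [k /andP[_ /eqP]//|none].
have : x \in opposite by rewrite -opposite_compl in_setC.
by move=> /imsetP[k kB Ex]; have := none k; rewrite kB Ex eqxx.
Qed.

Lemma prism_graph : rook_graph adj 1 (d - 1).
Proof.
have cB' : #|B| = (d - 1).+1 by rewrite cB; lia.
pose side x : 'I_2 := if x \in B then ord0 else ord_max.
have sideE x y : (side x == side y) = ((x \in B) == (y \in B)).
  by rewrite /side; case: (x \in B); case: (y \in B).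
have posE x y : (pos B (d - 1) (column x) == pos B (d - 1) (column y)) = (column x == column y).
  by apply/eqP/eqP => [|->//]; apply: pos_inj => //; exact: column_in.
exists side, (fun x => pos B (d - 1) (column x)); split.
- move=> x y [/eqP + /eqP]; rewrite sideE posE => /eqP xy /eqP; have [xB|xB] := boolP (x \in B).
    by rewrite /column -xy xB.
  by move=> /(congr1 partner); rewrite !partner_column // -xy.
- by have := cardsC B; rewrite opposite_compl card_opposite cB; card_lia.
move=> x y; rewrite sideE posE; have [->|xy] := eqVneq x y; first by rewrite adj_irr.
have mixed a b : a \in B -> b \notin B -> adj a b = (column a == column b).
  move=> aB bB; have -> : column a = a by rewrite /column aB.
  apply/idP/eqP => [ab|->]; last by rewrite -{2}(partner_column bB) adj_partner ?column_in.
  by apply: partner_inj; rewrite ?column_in // partner_column // (adj_out aB bB ab).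
have [xB|xB] := boolP (x \in B); have [yB|yB] := boolP (y \in B) => /=.
- by rewrite adj_block // eq_sym.
- exact: mixed.
- by rewrite adjC eq_sym; exact: mixed.
- by rewrite adj_opposite.
Qed.

End BlockOfSizeD.

(** * A block of size 3 for [d = 4]: the product of two triangles *)

Section BlockOfSize3.
Hypothesis d4 : d = 4.
Hypothesis cI : #|I| = 9.

Lemma regular4 v : #|nb v| = 4.
Proof. by rewrite regular ?d4 // cI. Qed.

Definition block3 X := (#|X| = 3) /\ exists s i, X = block s i.

(** The degree bound gives each of the three members at least two outside neighbours; these sets are
    disjoint and only six vertices are outside. *)
Lemma block3_out X : block3 X -> {in X, forall k, #|out X k| = 2}.
Proof.
move=> [c3 [s [i EX]]] k kX; rewrite EX in c3 kX *.
have ge2 j : j \in block s i -> 2 <= #|out (block s i) j|.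
  by move=> /out_ge; rewrite c3 d4; card_lia.
have : \sum_(j in block s i | j != k) 2 <= \sum_(j in block s i | j != k) #|out (block s i) j|.
  by apply: leq_sum => j /andP[/ge2].
have := card_out_sum s i; rewrite (bigD1 k) //= c3 cI sum_nat_const.
have -> : #|[pred j in block s i | j != k]| = 2.
  have := cardsD1 k (block s i); rewrite kX c3 => -[->].
  by apply: eq_card => l; rewrite !inE andbC.
by set sm := (\sum_(_ | _) _)%N; move: (ge2 k kX); card_lia.
Qed.

Lemma block3_adj X x y : block3 X -> x \in X -> y \in X -> x != y -> adj x y.
Proof.
move=> bX xX yX xy; have o2 := block3_out bX xX; case: bX => c3 [s [i EX]].
rewrite EX in c3 xX yX o2.
have : y \in nb x :&: block s i.
  have /eqP -> : nb x :&: block s i == block s i :\ x.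
    rewrite eqEcard nb_block_sub; have := regular4 x; rewrite (card_nb_split xX) o2.
    by have := cardsD1 x (block s i); rewrite xX c3; card_lia.
  by rewrite in_setD1 eq_sym xy.
by rewrite !inE => /andP[].
Qed.

Lemma block3_cover X w : block3 X -> w \notin X -> exists2 k, k \in X & w \in out X k.
Proof.
move=> bX wX; have o2 := block3_out bX; case: bX => c3 [s [i EX]]; rewrite EX in c3 o2 wX *.
suff : w \in \bigcup_(k in block s i) out (block s i) k by move=> /bigcupP[k]; exists k.
have /eqP -> : \bigcup_(k in block s i) out (block s i) k == ~: block s i.
  rewrite eqEcard cover_out_sub (leq_trans _ (sum_out_cover s i)) //.
  rewrite (eq_bigr _ o2) sum_nat_const c3.
  by have := cardsC (block s i); rewrite c3 cI; card_lia.
by rewrite in_setC.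
Qed.

Lemma block3_eq X Y x y : block3 X -> block3 Y -> x != y ->
  x \in X -> y \in X -> x \in Y -> y \in Y -> X = Y.
Proof.
move=> [_ [s [i ->]]] [_ [t [j ->]]] xy xX yX xY yY.
have st := mt_uniq xy (block_mt xX yX) (block_mt xY yY); rewrite -{t}st in xY yY *.
rewrite inE in xX; rewrite inE in xY.
apply/setP => z; rewrite !inE; apply/idP/idP => h.
  by rewrite (mt_trans xY) // (mt_mid xX).
by rewrite (mt_trans xX) // (mt_mid xY).
Qed.

Definition row X k : {set I} := k |: out X k.

Lemma block3_nomeet X j k w t : block3 X -> j \in X -> k \in X -> j != k ->
  w \in out X k -> ~~ mt t j w.
Proof.
move=> [_ [s [i ->]]] jX kX jk; rewrite in_setD => /andP[wX]; rewrite inE => kw.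
have [r rkw] := adj_mt kw; apply: contraNN wX => tjw.
exact: outside_block jX kX jk tjw rkw.
Qed.

(* If [p] and [r], the two outside neighbours of [k], were in different blocks, then [p] would
   have both outside neighbours of another member of [X] as neighbours, against [common_nb]. *)
Lemma block3_row X k : block3 X -> k \in X -> block3 (row X k).
Proof.
move=> bX kX; have /eqP := block3_out bX kX; rewrite -/(is_true _) => /cards2P[p [r [pr Eo]]].
have pk : p \in out X k by rewrite Eo set21.
have rk : r \in out X k by rewrite Eo set22.
have kp : adj k p by move: pk; rewrite !inE => /andP[].
have kr : adj k r by move: rk; rewrite !inE => /andP[].
have [t tkp] := adj_mt kp.
have pX : p \notin X by move: pk; rewrite in_setD => /andP[].
have knot : k \notin out X k by rewrite !inE adj_irr andbF.
have c3 : #|row X k| = 3 by rewrite cardsU1 knot block3_out.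
split => //; exists t, k.
have tkr : mt t k r.
  apply: contraT => ntkr.
  have npr : ~~ adj p r.
    apply/negP => apr; have [t' tpr] := adj_mt apr.
    case/negP: ntkr; have E : t = t'.
      have [t2 tkr] := adj_mt kr.
      exact: (mt_triangle (adj_neq kp) pr (adj_neq kr) tkp tpr tkr).
    by apply: mt_trans tkp _; rewrite E.
  have sub : nb p :\ k \subset \bigcup_(j in X :\ k) out X j.
    apply/subsetP => w; rewrite in_setD1 inE => /andP[wk pw].
    have wX : w \notin X.
      apply/negP => wX; have [t' tpw] := adj_mt pw.
      by case/negP: (block3_nomeet t' bX wX kX wk pk); rewrite mtC.
    have [j jX jw] := block3_cover bX wX; apply/bigcupP; exists j => //.
    rewrite in_setD1 jX andbT; apply/negP => /eqP jk; rewrite jk Eo in jw.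
    by case/set2P: jw pw => ->; rewrite ?adj_irr // (negPf npr).
  (* Pigeonhole: the three neighbours of [p] other than [k] are spread over the outside pairs of two
     members. The member [j] found here then has three common neighbours with [p], namely [k] and
     its own pair, where [common_nb] allows two. *)
  have [j jX big] : exists2 j, j \in X :\ k & out X j \subset nb p.
    apply/exists_inP; apply: contraT => /exists_inPn none.
    have c2 : #|X :\ k| = 2 by have := cardsD1 k X; rewrite kX bX.1; card_lia.
    have : #|nb p :\ k| <= \sum_(j in X :\ k) #|nb p :&: out X j|.
      apply: leq_trans (leq_card_bigcup _ _); apply: subset_leq_card.
      apply/subsetP => w wp; have /bigcupP[j jX jw] := subsetP sub _ wp.
      apply/bigcupP; exists j => //; rewrite in_setI jw andbT.
      by move: wp; rewrite in_setD1 => /andP[].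
    have : \sum_(j in X :\ k) #|nb p :&: out X j| <= \sum_(j in X :\ k) 1.
      apply: leq_sum => j jX; have := none j jX; rewrite -ltnS.
      have jX' : j \in X by move: jX; rewrite in_setD1 => /andP[].
      rewrite -(block3_out bX jX'); apply: contraNT; rewrite -leqNgt => le.
      have /eqP <- : nb p :&: out X j == out X j by rewrite eqEcard subsetIr.
      exact: subsetIl.
    rewrite sum1_card c2; have := cardsD1 k (nb p); rewrite inE adjC kp regular4.
    by set sm := (\sum_(_ in _) _)%N; card_lia.
  move: jX; rewrite in_setD1 => /andP[jk jX].
  have := common_nb (fun t' => block3_nomeet t' bX jX kX jk pk).
  have : k |: out X j \subset nb j :&: nb p.
    apply/subsetP => w; rewrite in_setU1 in_setI => /orP[/eqP->|wj].
      by rewrite inE (block3_adj bX) //= inE adjC.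
    by rewrite (subsetP big) // andbT; move: wj; rewrite in_setD => /andP[].
  move=> /subset_leq_card; rewrite cardsU1 block3_out // regular4 d4.
  by rewrite !inE (_ : k \in X) // andFb /=; card_lia.
apply/eqP; rewrite eqEsubset; apply/andP; split.
  by apply/subsetP => w; rewrite in_setU1 Eo => /orP[/eqP->|/set2P[]->]; rewrite ?block_self // inE.
apply/subsetP => w; rewrite inE => tkw; rewrite in_setU1.
have [->|wk] //= := eqVneq w k.
have [wX|wX] := boolP (w \in X).
  have [s [i EX]] := bX.2; rewrite EX in wX kX pX.
  have E : s = t by apply: (mt_uniq _ (block_mt kX wX) tkw); rewrite eq_sym.
  by case/negP: pX; apply: block_mem kX _; rewrite E.
have [j jX jw] := block3_cover bX wX.
have [<-//|jk] := eqVneq j k.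
have kj : k != j by rewrite eq_sym.
by have := block3_nomeet t bX kX jX kj jw; rewrite tkw.
Qed.

Definition row_index X x : I :=
  if x \in X then x else odflt x [pick k in X | x \in out X k].

Lemma row_index_in X x : block3 X -> row_index X x \in X.
Proof.
move=> bX; rewrite /row_index; case: ifPn => // xX; case: pickP => [k /andP[]//|none].
by have [k kX kx] := block3_cover bX xX; have := none k; rewrite kX kx.
Qed.

Lemma mem_row_index X x : block3 X -> x \in row X (row_index X x).
Proof.
move=> bX; rewrite /row_index in_setU1; case: ifPn => [_|xX]; first by rewrite eqxx.
case: pickP => [k /andP[_ ->]|none]; first by rewrite orbT.
by have [k kX kx] := block3_cover bX xX; have := none k; rewrite kX kx.
Qed.

Lemma row_setI X k x : k \in X -> x \in row X k -> x \in X -> x = k.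
Proof. by move=> kX; rewrite in_setU1 in_setD => /orP[/eqP//|/andP[/negPf->]]. Qed.

Lemma row_index_row X x k : block3 X -> k \in X -> x \in row X k -> row_index X x = k.
Proof.
move=> bX kX xk; have jX := row_index_in x bX; have := mem_row_index x bX.
move: (row_index X x) jX => j jX xj.
have [xX|xX] := boolP (x \in X); first by rewrite -(row_setI jX xj) // (row_setI kX xk).
have xj' : x \in out X j by move: xj; rewrite in_setU1 => /orP[/eqP xj'|//]; rewrite xj' jX in xX.
have xk' : x \in out X k by move: xk; rewrite in_setU1 => /orP[/eqP xk'|//]; rewrite xk' kX in xX.
have [_ [s [i EX]]] := bX; rewrite EX in jX kX xj' xk'.
exact: out_inj jX kX xj' xk'.
Qed.

(** [Y] is the row of [X] through [i], and [X] is in turn the row of [Y] through [i]. The two row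
    indices serve as coordinates of a three by three grid. *)
Lemma duoprism_graph X : block3 X -> rook_graph adj 2 2.
Proof.
move=> bX; have [i iX] : exists i, i \in X by apply/card_gt0P; rewrite bX.1.
set Y := row X i; have bY : block3 Y := block3_row bX iX.
have iY : i \in Y by rewrite /Y /row setU11.
have rowYi : row Y i = X.
  have [j /[!in_setD1] /andP[ji jX]] : exists j, j \in X :\ i.
    by apply/card_gt0P; have := cardsD1 i X; rewrite iX bX.1; card_lia.
  have ij : i != j by rewrite eq_sym.
  apply: (block3_eq (block3_row bY iY) bX ij) => //; first by rewrite /row setU11.
  have jnb : j \in nb i by rewrite inE (block3_adj bX).
  rewrite in_setU1 in_setD jnb andbT.
  by rewrite (contraNN _ ji) ?orbT // => /(row_setI iX)/(_ jX)->.
have inj x y : row_index X x = row_index X y -> row_index Y x = row_index Y y -> x = y.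
  move: (mem_row_index x bX) (mem_row_index y bX) (mem_row_index x bY) (mem_row_index y bY).
  move=> xk yk xl yl Ek El; rewrite -{}Ek in yk; rewrite -{}El in yl.
  move: (row_index_in x bX) (row_index_in x bY) xk yk xl yl.
  move: (row_index X x) (row_index Y x) => k l kX lY xk yk xl yl.
  apply/eqP; apply: contraT => xy.
  (* The two rows share [x] and [y], so they coincide. If [k = i] the common row is [Y], and if
     [l = i] it is [X], although a row of a block meets it in one point only; otherwise [l] is an
     outside neighbour of both [i] and [k]. *)
  have E := block3_eq (block3_row bX kX) (block3_row bY lY) xy xk yk xl yl.
  have kl : k \in row Y l by rewrite -E setU11.
  have lk : l \in row X k by rewrite E setU11.
  have big Z j : block3 Z -> j \in Z -> ~ Z \subset row Z j.
    move=> bZ jZ sub; have := subset_leq_card sub; have : Z \subset [set j].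
      by apply/subsetP => w wZ; rewrite in_set1 (row_setI jZ (subsetP sub w wZ) wZ).
    by move=> /subset_leq_card; rewrite cards1 bZ.1.
  have [ki|ki] := eqVneq k i.
    by case: (big Y l bY lY); rewrite -E ki.
  have [li|li] := eqVneq l i.
    by case: (big X k bX kX); rewrite E li rowYi.
  have lX : l \notin X by apply: contraNN li => lX; rewrite (row_setI iX lY lX).
  have lo : l \in out X i by move: lY; rewrite in_setU1 (negPf li).
  have lo' : l \in out X k.
    by move: lk; rewrite in_setU1 => /orP[/eqP lk'|//]; rewrite lk' kX in lX.
  have [_ [s [j EX]]] := bX; rewrite EX in kX iX lo lo'.
  by rewrite (out_inj kX iX lo' lo) eqxx in ki.
have posE Z x y : block3 Z ->
    (pos Z 2 (row_index Z x) == pos Z 2 (row_index Z y)) = (row_index Z x == row_index Z y).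
  move=> bZ; apply/eqP/eqP => [|->//].
  by apply: pos_inj (row_index_in _ _) (row_index_in _ _); rewrite ?bZ.1.
exists (fun x => pos X 2 (row_index X x)), (fun x => pos Y 2 (row_index Y x)); split => //.
  by move=> x y [/eqP + /eqP]; rewrite !posE // => /eqP + /eqP; exact: inj.
move=> x y; rewrite !posE //.
have [->|xy] /= := eqVneq x y; first by rewrite adj_irr.
have mem Z : block3 Z -> row_index Z x = row_index Z y -> y \in row Z (row_index Z x).
  by move=> bZ ->; exact: mem_row_index.
apply/idP/orP => [axy|]; last first.
  have adj_row Z : block3 Z -> row_index Z x == row_index Z y -> adj x y.
    move=> bZ /eqP E; apply: (block3_adj (block3_row bZ (row_index_in x bZ))) => //.
      exact: mem_row_index.
    exact: mem.
  by case=> [/(adj_row _ bX)|/(adj_row _ bY)].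
set RX := row X (row_index X x); set RY := row Y (row_index Y x).
have bRX : block3 RX := block3_row bX (row_index_in x bX).
have bRY : block3 RY := block3_row bY (row_index_in x bY).
have xRX : x \in RX := mem_row_index x bX; have xRY : x \in RY := mem_row_index x bY.
(* The two further members of each row through [x] already make up its four neighbours. *)
have : y \in (RX :\ x) :|: (RY :\ x).
  have /eqP -> : (RX :\ x) :|: (RY :\ x) == nb x; last by rewrite inE.
  rewrite eqEcard regular4; apply/andP; split.
    apply/subsetP => w /setUP[] /setD1P[wx wR]; rewrite inE.
      by apply: (block3_adj bRX); rewrite // eq_sym.
    by apply: (block3_adj bRY); rewrite // eq_sym.
  have -> : #|(RX :\ x) :|: (RY :\ x)| = #|RX :\ x| + #|RY :\ x|.
    apply/eqP; rewrite cardsU (_ : _ :&: _ = set0) ?cards0 ?subn0 //.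
    apply/setP => w; rewrite in_set0 in_setI 2!in_setD1; apply/negP.
    move=> /andP[/andP[wx wX] /andP[_ wY]]; case/eqP: wx; apply: inj.
      by apply: row_index_row => //; exact: row_index_in.
    by apply: row_index_row => //; exact: row_index_in.
  have := cardsD1 x RX; have := cardsD1 x RY; rewrite xRX xRY bRX.1 bRY.1; card_lia.
move=> /setUP[] /setD1P[_ yR]; [left|right].
  by rewrite (row_index_row bX _ yR) ?row_index_in.
by rewrite (row_index_row bY _ yR) ?row_index_in.
Qed.

End BlockOfSize3.

(** * Blocks of size 2 and blocks of size above [d] *)

Definition is_rook := rook_graph adj 1 (d - 1) \/ (d = 4 /\ rook_graph adj 2 2).

Lemma block_dichotomy s i : 1 < #|block s i| ->
  is_rook \/ (#|block s i| = 2 \/ d < #|block s i|).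
Proof.
move=> /block_card_cases[->|cB|->|[d4 c3 c9]]; first by right; left.
- by left; left; exact: prism_graph cB.
- by right; right.
- left; right; split => //; apply: (duoprism_graph d4 c9 (X := block s i)).
  by split => //; exists s, i.
Qed.

Lemma block_gt1 s i j : i != j -> mt s i j -> 1 < #|block s i|.
Proof.
move=> ij sij; have : [set i; j] \subset block s i.
  by apply/subsetP => k /set2P[]->; rewrite ?block_self // inE.
by move=> /subset_leq_card; rewrite cards2 ij.
Qed.

Lemma block2E s i j : i != j -> mt s i j -> #|block s i| = 2 -> block s i = [set i; j].
Proof.
move=> ij sij c2; apply/esym/eqP; rewrite eqEcard c2 cards2 ij andbT.
by apply/subsetP => k /set2P[]->; rewrite ?block_self // inE.
Qed.

Lemma block_eq s i j : mt s i j -> block s i = block s j.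
Proof.
move=> sij; apply/setP => k; rewrite !inE; apply/idP/idP; first exact: mt_mid.
exact: mt_trans.
Qed.

(* Two distinct large blocks at [v] would cover everything, making [v] a vertex of degree [2 d]. *)
Lemma two_large_blocks s t v : s != t -> d < #|block s v| -> d < #|block t v| -> False.
Proof.
move=> st c1 c2.
have capE : block s v :&: block t v = [set v].
  apply/setP => y; rewrite in_setI in_set1; have [->|yv] := eqVneq y v.
    by rewrite !block_self.
  rewrite !inE; apply/negP => /andP[sy ty]; case/eqP: st.
  by apply: mt_uniq sy ty; rewrite eq_sym.
have cU : #|block s v :|: block t v| = #|block s v| + #|block t v| - 1.
  by rewrite cardsU capE cards1.
have cT := subset_leq_card (subsetT (block s v :|: block t v)); rewrite cardsT in cT.
have cI : #|I| = 2 * d + 1 by move: cU cT c1 c2; card_lia.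
have UT : block s v :|: block t v = setT.
  by apply/eqP; rewrite eqEcard subsetT cardsT; move: cU c1 c2 cI; card_lia.
have reg := regular cI.
have half a b : a != b -> block a v :|: block b v = setT -> #|block a v| = d.+1 ->
    block a v :\ v \subset nb v.
  move=> ab abT ca; apply/subsetP => u /setD1P[uv]; rewrite inE => auv.
  have sub : nb u \subset block a v :\ u.
    apply/subsetP => w; rewrite inE => uw; rewrite in_setD1 eq_sym (adj_neq uw) /=.
    have : w \in block a v :|: block b v by rewrite abT inE.
    move=> /setUP[//|wb]; have [->|wv] := eqVneq w v; first exact: block_self.
    have [r ruw] := adj_mt uw; have vw : v != w by rewrite eq_sym.
    have : u \in block b v.
      by apply: (outside_block (block_self b v) wb vw (t := a) (r := r)); rewrite // mtC.
    rewrite inE => buv; case/eqP: ab; apply: mt_uniq auv buv; by rewrite eq_sym.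
  have E : nb u = block a v :\ u.
    apply/eqP; rewrite eqEcard sub reg; have := cardsD1 u (block a v).
    by rewrite inE auv ca; card_lia.
  have : v \in nb u by rewrite E in_setD1 eq_sym uv block_self.
  by rewrite !inE adjC.
have c1' : #|block s v| = d.+1 by move: cU cT c1 c2; card_lia.
have c2' : #|block t v| = d.+1 by move: cU cT c1 c2; card_lia.
have : (block s v :\ v) :|: (block t v :\ v) \subset nb v.
  apply/subUsetP; split; first exact: half st UT c1'.
  have ts : t != s by rewrite eq_sym.
  by apply: half ts _ c2'; rewrite setUC.
rewrite -setDUl UT => /subset_leq_card; rewrite reg.
by have := cardsD1 v [set: I]; rewrite in_setT cardsT cI; card_lia.
Qed.

(** The large block at [u], the vertex [v] and the other neighbours of [v] are disjoint and already
    make up [2 d + 1] vertices, so nothing else exists. A vertex [w] of the last group has at most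
    one neighbour in the large block, hence also a neighbour [w'] in its own group. The triangle
    [v], [w], [w'] lies in a block of size between 3 and [d], and [block_dichotomy] settles such
    sizes. *)
Lemma mixed_blocks s t u v : adj u v -> mt t u v -> #|block t u| = 2 ->
  d < #|block s u| -> is_rook.
Proof.
move=> uv tuv c2 cs; have Et := block2E (adj_neq uv) tuv c2.
set B := block s u; set N' := nb v :\ u.
have small y a b : mt a u y -> mt b v y -> y = u \/ y = v.
  move=> auy bvy; apply/set2P; rewrite -Et.
  apply: (outside_block (block_self t u) _ (adj_neq uv) auy bvy); by rewrite inE.
have vB : v \notin B.
  rewrite inE; apply/negP => suv; have E := mt_uniq (adj_neq uv) suv tuv.
  by move: cs; rewrite E c2; lia.
have BN : [disjoint B & N'].
  rewrite disjoint_subset; apply/subsetP => y; rewrite !inE => suy.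
  rewrite negb_and negbK; have [//|yu] := eqVneq y u; apply/negP => vy.
  have [r rvy] := adj_mt vy; case: (small y s r suy rvy) => E; first by rewrite E eqxx in yu.
  by rewrite E adj_irr in vy.
have cN : d.-1 <= #|N'|.
  by have := cardsD1 u (nb v); rewrite inE adjC uv; have := deg_ge v; card_lia.
have vN : v \notin N' by rewrite !inE adj_irr andbF.
have cU : #|v |: (B :|: N')| = (#|B| + #|N'|).+1.
  rewrite cardsU1 in_setU negb_or vB vN cardsU.
  by move: BN; rewrite -setI_eq0 => /eqP->; rewrite cards0 subn0.
have cT := subset_leq_card (subsetT (v |: (B :|: N'))); rewrite cardsT in cT.
have cN1 : #|N'| = d.-1 by move: cU cT cs cN; rewrite -/B; card_lia.
have UT : v |: (B :|: N') = setT.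
  by apply/eqP; rewrite eqEcard subsetT cardsT; move: cU cs cN; rewrite -/B; card_lia.
have [w wN] : exists w, w \in N' by apply/card_gt0P; rewrite cN1; move: d_ge3; lia.
have [wu vw] : w != u /\ adj v w by move: wN; rewrite !inE => /andP[].
have wB : w \notin B by apply: contraTN wN => /(disjointFr BN)->.
have cB1 : #|nb w :&: B| <= 1.
  rewrite leqNgt; apply/negP => /card_gt1P[b [b' [/setIP[wb bB] /setIP[wb' bB'] bb']]].
  case/negP: wB; rewrite inE in wb; rewrite inE in wb'.
  have [a awb] := adj_mt wb; have [a' awb'] := adj_mt wb'.
  by apply: (outside_block bB bB' bb' (t := a) (r := a')); rewrite mtC.
have [w' ww' w'N] : exists2 w', adj w w' & w' \in N'.
  have : 0 < #|nb w :&: N'|.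
    have sub : nb w \subset v |: ((nb w :&: B) :|: (nb w :&: N')).
      apply/subsetP => y yw; have : y \in v |: (B :|: N') by rewrite UT inE.
      by rewrite !in_setU !in_setI yw /=.
    have := leq_trans (deg_ge w) (subset_leq_card sub).
    have := leq_card_setU (nb w :&: B) (nb w :&: N'); rewrite cardsU1 => -[le _].
    move: le cB1 d_ge3; case: (v \notin _) => /=; card_lia.
  by case/card_gt0P => w' /setIP[]; rewrite inE; exists w'.
have [r rvw] := adj_mt vw.
have w'r : w' \in block r v.
  have [a aww'] := adj_mt ww'.
  have : adj v w' by move: w'N; rewrite !inE => /andP[].
  move=> /adj_mt[b bvw']; apply: (outside_block (block_self r v) _ (adj_neq vw) bvw' aww').
  by rewrite inE.
(* A vertex of [B] in this block meets both [u] and [v], so it is [u]; but then [w] would meet both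
   [u] and [v] as well. *)
have sub : block r v \subset v |: N'.
  apply/subsetP => y; rewrite inE => rvy.
  have : y \in v |: (B :|: N') by rewrite UT inE.
  rewrite in_setU1 in_setU => /or3P[/eqP->|yB|yN]; rewrite in_setU1 ?eqxx ?yN ?orbT //.
  have suy : mt s u y by rewrite inE in yB.
  case: (small y s r suy rvy) => E; last by rewrite E eqxx.
  rewrite E mtC in rvy; case: (small w r r (mt_trans rvy rvw) rvw) => E'.
    by rewrite E' eqxx in wu.
  by rewrite E' adj_irr in vw.
have c_le := subset_leq_card sub; rewrite cardsU1 vN cN1 in c_le.
have c_ge : 3 <= #|block r v|.
  have : w' |: [set v; w] \subset block r v.
    by apply/subsetP => y /setU1P[->//|/set2P[]->]; rewrite ?block_self // inE.
  move=> /subset_leq_card; rewrite cardsU1 cards2 (adj_neq vw) !inE negb_or.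
  have -> : w' != v by apply: contraNneq vN => <-.
  by rewrite eq_sym (adj_neq ww').
have [//|[c2'|cd]] := block_dichotomy (ltnW c_ge); first by rewrite c2' in c_ge.
by move: c_le cd d_ge3; rewrite /= ; card_lia.
Qed.

(** Take another neighbour [a] of [u]. If the block of [u] and [a] also has size 2, then [v] and [a]
    do not meet, and neither of them has a neighbour in common with [u]. So [nb v] and [nb a] lie in
    the complement of [nb u], and with [common_nb] this requires at least [3 d - 2] vertices. *)
Lemma block_of_size2 s v u : adj v u -> mt s v u -> #|block s v| = 2 -> is_rook.
Proof.
move=> vu svu c2; have Es := block2E (adj_neq vu) svu c2.
have [a /setD1P[av]] : exists a, a \in nb u :\ v.
  apply/card_gt0P; have := cardsD1 v (nb u); rewrite inE adjC vu.
  by have := deg_ge u; card_lia.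
rewrite inE => ua; have [t tua] := adj_mt ua.
have [//|[c2'|cd]] := block_dichotomy (block_gt1 (adj_neq ua) tua); last first.
  apply: (mixed_blocks (s := t) (t := s) (u := u) (v := v)) => //; rewrite 1?adjC 1?mtC //.
  by rewrite -(block_eq svu).
have Et := block2E (adj_neq ua) tua c2'.
have nomeet r : ~~ mt r v a.
  apply/negP => rva; have : a \in block s v.
    by apply: (outside_block (block_self s v) _ (adj_neq vu) rva tua); rewrite inE.
  by rewrite Es => /set2P[] E; [rewrite E eqxx in av | rewrite E adj_irr in ua].
have disj b x y : mt b x y -> adj x y -> block b x = [set x; y] -> nb x \subset ~: nb y.
  move=> bxy xy E; apply/subsetP => w; rewrite !inE => xw; apply/negP => yw.
  have [e exw] := adj_mt xw; have [f fyw] := adj_mt yw.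
  have : w \in block b x.
    by apply: (outside_block (block_self b x) _ (adj_neq xy) exw fyw); rewrite inE.
  by rewrite E => /set2P[] Ew; [rewrite Ew adj_irr in xw | rewrite Ew adj_irr in yw].
have subv := disj s v u svu vu Es.
have suba : nb a \subset ~: nb u.
  by rewrite subsetC; exact: disj t u a tua ua Et.
have := common_nb nomeet.
have := cardsUI (nb v) (nb a).
have /subset_leq_card : nb v :|: nb a \subset ~: nb u by rewrite subUset subv.
have := cardsC (nb u); have := deg_ge a; have := deg_ge v; have := deg_ge u.
(* For [d >= 4] this follows from [2 d + 1]. For [d = 3] that bound is 7, one too large, hence the
   separate hypothesis [card_le6]. *)
have : #|I| <= 3 * d - 3.
  have [d3|d3] := eqVneq d 3; first by have := card_le6 d3; rewrite d3.
  by move: d3; card_lia.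
card_lia.
Qed.

Theorem adj_is_rook : is_rook.
Proof.
have [v [u [w [s [vu vw svu nsvw]]]]] := two_blocks.
have [t tvw] := adj_mt vw.
have [//|[|c1]] := block_dichotomy (block_gt1 (adj_neq vu) svu); first exact: block_of_size2 vu svu.
have [//|[|c2]] := block_dichotomy (block_gt1 (adj_neq vw) tvw); first exact: block_of_size2 vw tvw.
case: (two_large_blocks _ c1 c2); by apply: contraNneq nsvw => ->.
Qed.

End RookGraphs.

(** * Facets and degrees in a rook graph *)

Section RookFacets.
Variables (I : finType) (A1 A2 : finType) (adj : rel I) (g1 : I -> A1) (g2 : I -> A2).
Hypothesis g_inj : injective (fun i => (g1 i, g2 i)).
Hypothesis g_surj : forall a b, exists i, g1 i = a /\ g2 i = b.
Hypothesis adjE : forall i j, adj i j = (i != j) && ((g1 i == g1 j) || (g2 i == g2 j)).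

(** For [u] outside the column of [w], the vertex [m] in the row of [v] and the column of [u] lies
    in [F] and already has [w] as its neighbour outside, so [u] is in [F]. Conversely, if [u] is in
    the column of [w], the vertex in its row and the column of [v] lies in [F], and its neighbour
    outside can only be [u]. *)
Lemma rook_facet (F : {set I}) v w : g1 v = g1 w -> g2 v != g2 w ->
  v \in F -> w \notin F -> (forall k, adj v k -> k != w -> k \in F) ->
  (forall u, u \in F -> #|nb adj u :\: F| = 1) ->
  forall u, (u \in F) = (g2 u != g2 w).
Proof.
move=> g1vw g2vw vF wF nbF outF.
have inF k : (g1 k == g1 v) || (g2 k == g2 v) -> k != w -> k \in F.
  move=> gk kw; have [->//|kv] := eqVneq k v; apply: nbF => //.
  by rewrite adjE eq_sym kv [g1 v == _]eq_sym [g2 v == _]eq_sym.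
have mid u : g2 u != g2 w -> u \in F.
  move=> uw; have [m [m1 m2]] := g_surj (g1 v) (g2 u).
  have neq k : g2 k != g2 w -> k != w by apply: contraNneq => ->.
  have mF : m \in F by apply: inF; rewrite ?m1 ?eqxx // neq // m2.
  apply: contraT => uF; have /eqP/cards1P[y Ey] := outF m mF.
  have um : u != m by apply: contraNneq uF => ->.
  have : u \in nb adj m :\: F by rewrite !inE uF adjE eq_sym um m2 eqxx orbT.
  have : w \in nb adj m :\: F.
    by rewrite !inE wF adjE m1 g1vw eqxx andbT; apply: neq; rewrite m2.
  by rewrite Ey => /set1P Ew /set1P Eu; rewrite Eu Ew eqxx in uw.
move=> u; apply/idP/idP => [uF|]; last exact: mid.
apply: contraTneq uF => uw; have [m [m1 m2]] := g_surj (g1 u) (g2 v).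
have mF : m \in F by apply: mid; rewrite m2.
have /eqP/cards1P[y Ey] := outF m mF.
have : y \in nb adj m :\: F by rewrite Ey set11.
rewrite !inE adjE => /andP[yF /andP[my]].
have y2 : g2 y = g2 w by apply/eqP; apply: contraNT yF; exact: mid.
rewrite m2 y2 (negPf g2vw) orbF m1 => /eqP y1.
suff -> : u = y by [].
by apply: g_inj; rewrite y1 y2 uw.
Qed.

End RookFacets.

Section RookGraph.
Variables (I : finType) (p q : nat) (adj : rel I) (g1 : I -> 'I_p.+1) (g2 : I -> 'I_q.+1).
Hypothesis g_inj : injective (fun i => (g1 i, g2 i)).
Hypothesis cI : #|I| = p.+1 * q.+1.
Hypothesis adjE : forall i j, adj i j = (i != j) && ((g1 i == g1 j) || (g2 i == g2 j)).

Lemma rook_surj a b : exists i, g1 i = a /\ g2 i = b.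
Proof.
have [h _ hK] : bijective (fun i => (g1 i, g2 i)).
  by apply: inj_card_bij => //; rewrite card_prod !card_ord cI.
by exists (h (a, b)); have := hK (a, b) => -[-> ->].
Qed.

Lemma rook_degree v : #|nb adj v| = p + q.
Proof.
have nbE : nb adj v = ([set u | g1 u == g1 v] :\ v) :|: ([set u | g2 u == g2 v] :\ v).
  apply/setP => u; rewrite !inE adjE eq_sym -andb_orr.
  by rewrite [g1 v == _]eq_sym [g2 v == _]eq_sym.
have c1 : #|[set u | g1 u == g1 v]| = q.+1.
  rewrite -[RHS]card_ord -cardsT -(card_in_imset (f := g2)).
    apply: eq_card => b; rewrite in_setT; apply/imsetP.
    by have [u [u1 u2]] := rook_surj (g1 v) b; exists u; rewrite ?inE ?u1.
  by move=> x y; rewrite !inE => /eqP x1 /eqP y1 xy; apply: g_inj; rewrite x1 y1 xy.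
have c2 : #|[set u | g2 u == g2 v]| = p.+1.
  rewrite -[RHS]card_ord -cardsT -(card_in_imset (f := g1)).
    apply: eq_card => a; rewrite in_setT; apply/imsetP.
    by have [u [u1 u2]] := rook_surj a (g2 v); exists u; rewrite ?inE ?u2.
  by move=> x y; rewrite !inE => /eqP x1 /eqP y1 xy; apply: g_inj; rewrite x1 y1 xy.
rewrite nbE cardsU.
have -> : ([set u | g1 u == g1 v] :\ v) :&: ([set u | g2 u == g2 v] :\ v) = set0.
  apply/setP => u; rewrite !inE; apply/negP => /andP[/andP[uv /eqP u1] /andP[_ /eqP u2]].
  by case/eqP: uv; apply: g_inj; rewrite u1 u2.
move: (cardsD1 v [set u | g1 u == g1 v]) (cardsD1 v [set u | g2 u == g2 v]).
rewrite !inE !eqxx c1 c2 cards0 subn0 /= !add1n => -[<-] [<-].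
exact: addnC.
Qed.

End RookGraph.

From HB Require Import structures.
From mathcomp Require Import all_order all_algebra.
From mathcomp Require Import all_classical all_reals all_analysis.
From mathcomp Require Import ring lra.
Require Import Defs.
Import Order.TTheory GRing.Theory Num.Theory.
Local Open Scope classical_set_scope.
Local Open Scope ring_scope.

(** * Theorems of the alternative *)

Section Farkas.
Variables (R : realFieldType).

Definition linear_form (U : lmodType R) (f : U -> R) :=
  forall c u v, f (c *: u + v) = c * f u + f v.

(* Bartl's induction on the number of forms. *)
Lemma farkas_forms (U : lmodType R) (I : eqType) (r : seq I) (al : I -> U -> R) (ga : U -> R) :
  uniq r -> (forall i, linear_form (al i)) -> linear_form ga ->
  (forall y, (forall i, i \in r -> al i y <= 0) -> ga y <= 0) ->
  exists la : I -> R, (forall i, 0 <= la i) /\ forall y, ga y = \sum_(i <- r) la i * al i y.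
Proof.
elim: r al ga => [|i0 r IH] al ga /=.
  move=> _ _ lga H; exists (fun=> 0); split => // y; rewrite big_nil.
  have g0 : ga 0 = 0 by have := lga 1 0 0; rewrite scaler0 addr0; lra.
  have h1 : ga y <= 0 by exact: H.
  have h2 : ga (-1 *: y + 0) <= 0 by exact: H.
  by move: h2; rewrite lga g0; lra.
move=> /andP[i0r ur] lal lga H.
have [H'|] := pselect (forall y, (forall i, i \in r -> al i y <= 0) -> ga y <= 0).
  have [la [la0 E]] := IH al ga ur lal lga H'.
  exists (fun i => if i == i0 then 0 else la i); split => [i|y]; first by case: ifP.
  rewrite big_cons eqxx mul0r add0r E !big_seq; apply: eq_bigr => i ir.
  by case: eqP => // ii0; rewrite -ii0 ir in i0r.
move=> /existsNP[x /not_implyP[xr /negP]]; rewrite -ltNge => gx.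
have c_gt0 : 0 < al i0 x.
  rewrite ltNge; apply/negP => ax; suff : ga x <= 0 by rewrite leNgt gx.
  by apply: H => i; rewrite inE => /orP[/eqP->//|]; exact: xr.
set c := al i0 x in c_gt0.
have cN : c != 0 by rewrite gt_eqF.
(* These are the forms composed with the projection along [x] onto the kernel of [al i0]. The
   multiplier of [i0] is recovered at the end by evaluating at [x]; it is nonnegative because
   [ga x > 0] while the other forms are at most 0 there. *)
pose al' i y := al i y - al i x / c * al i0 y.
pose ga' y := ga y - ga x / c * al i0 y.
have H' y : (forall i, i \in r -> al' i y <= 0) -> ga' y <= 0.
  move=> ay; have E f : linear_form f -> f (- (al i0 y / c) *: x + y) = f y - f x / c * al i0 y.
    by move=> ->; rewrite addrC mulNr; congr (_ - _); ring.
  rewrite /ga' -E //; apply: H => i; rewrite inE E // => /orP[/eqP->|/ay//].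
  by rewrite -/c divff // mul1r subrr.
have lal' i : linear_form (al' i).
  by move=> a u v; rewrite /al' !lal; ring.
have lga' : linear_form ga' by move=> a u v; rewrite /ga' lga lal; ring.
have [la [la0 E]] := IH al' ga' ur lal' lga' H'.
exists (fun i => if i == i0 then (ga x - \sum_(j <- r) la j * al j x) / c else la i).
split=> [i|y].
  case: ifP => // _; apply: divr_ge0; last exact: ltW.
  rewrite subr_ge0 (le_trans _ (ltW gx)) // big_seq; apply: sumr_le0 => j jr.
  by rewrite mulr_ge0_le0 ?xr.
rewrite big_cons eqxx.
have -> : \sum_(j <- r)
      (if j == i0 then (ga x - \sum_(j <- r) la j * al j x) / c else la j) * al j y
   = \sum_(j <- r) la j * al j y.
  by rewrite !big_seq; apply: eq_bigr => j jr; case: eqP => // ji; rewrite -ji jr in i0r.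
have := E y; rewrite /ga' /al'.
have -> : \sum_(i <- r) la i * (al i y - al i x / c * al i0 y)
  = \sum_(i <- r) la i * al i y - (\sum_(i <- r) la i * al i x) / c * al i0 y.
  rewrite !mulr_suml -sumrB; apply: eq_bigr => i _; ring.
by move/(canRL (subrK _)) => ->; ring.
Qed.

End Farkas.

Section Dot.
Variables (R : realType) (n : nat).
Implicit Types (a x y : 'rV[R]_n).

Lemma dotvC a x : dotv a x = dotv x a.
Proof. by apply: eq_bigr => i _; rewrite mulrC. Qed.

Lemma dotvDr a x y : dotv a (x + y) = dotv a x + dotv a y.
Proof. by rewrite -big_split; apply: eq_bigr => i _; rewrite mxE mulrDr. Qed.

Lemma dotvZr a (c : R) x : dotv a (c *: x) = c * dotv a x.
Proof. by rewrite mulr_sumr; apply: eq_bigr => i _; rewrite mxE mulrCA. Qed.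

Lemma dotvBr a x y : dotv a (x - y) = dotv a x - dotv a y.
Proof. by rewrite dotvDr -scaleN1r dotvZr mulN1r. Qed.

Lemma dotv0r a : dotv a 0 = 0.
Proof. by rewrite -(subrr 0) dotvBr subrr. Qed.

Lemma dotv_sumr (I : Type) (r : seq I) (P : pred I) (F : I -> 'rV[R]_n) a :
  dotv a (\sum_(i <- r | P i) F i) = \sum_(i <- r | P i) dotv a (F i).
Proof.
elim/big_rec2: _ => [|i x y _ <-]; first exact: dotv0r.
exact: dotvDr.
Qed.

Lemma dotvDl a x y : dotv (x + y) a = dotv x a + dotv y a.
Proof. by rewrite dotvC dotvDr !(dotvC a). Qed.

Lemma dotvZl a (c : R) x : dotv (c *: x) a = c * dotv x a.
Proof. by rewrite dotvC dotvZr (dotvC a). Qed.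

Lemma dotvNl a x : dotv (- x) a = - dotv x a.
Proof. by rewrite -scaleN1r dotvZl mulN1r. Qed.

Lemma dotv_eq0 x : (forall y, dotv y x = 0) -> x = 0.
Proof.
move=> H; apply/rowP => i; have := H (delta_mx 0 i).
rewrite /dotv (bigD1 i) //= big1 => [|j ji]; first by rewrite !mxE !eqxx mul1r addr0.
by rewrite mxE eqxx (negPf ji) mul0r.
Qed.

(** Farkas on pairs [(y, m)], where [m] is a margin with [m <= dotv y (b j)] and each equation is
    split into two inequalities. Either a positive margin is possible, or the form [m] is a
    nonnegative combination of the constraints; its value at [(0, 1)] normalises the weights [mu],
    and its values at [(y, 0)] give the vector identity. *)
Lemma motzkin (I : finType) (Q E : pred I) (b e : I -> 'rV[R]_n) :
  (exists y, (forall j, E j -> dotv y (e j) = 0) /\ (forall j, Q j -> 0 < dotv y (b j))) \/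
  (exists mu t : I -> R, [/\ forall j, 0 <= mu j, \sum_(j | Q j) mu j = 1 &
     \sum_(j | Q j) mu j *: b j = \sum_(j | E j) t j *: e j]).
Proof.
pose U := ('rV[R]_n * R^o)%type.
pose J := (I + I + I)%type.
pose al (j : J) (u : U) : R := match j with
  | inl (inl j) => u.2 - dotv u.1 (b j)
  | inl (inr j) => dotv u.1 (e j)
  | inr j => - dotv u.1 (e j) end.
pose ga (u : U) : R := u.2.
pose A : pred J := fun j => match j with
  | inl (inl j) => Q j | inl (inr j) => E j | inr j => E j end.
have lal j : linear_form (al j).
  move=> c u v; case: j => [[j|j]|j] /=; rewrite dotvDl dotvZl //; last by rewrite opprD mulrN.
  by rewrite mulrBr opprD addrACA.
have lga : linear_form ga by [].
have [H|] := pselect (forall y : U, (forall j, j \in enum A -> al j y <= 0) -> ga y <= 0).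
  have [la [la0 Ela]] := farkas_forms (enum_uniq A) lal lga H.
  right; exists (fun j => la (inl (inl j))), (fun j => la (inl (inr j)) - la (inr j)).
  have S (u : U) : u.2 = \sum_(j | Q j) la (inl (inl j)) * (u.2 - dotv u.1 (b j))
       + \sum_(j | E j) (la (inl (inr j)) - la (inr j)) * dotv u.1 (e j).
    rewrite -[LHS]/(ga u) Ela big_enum big_sumType big_sumType /= -addrA.
    congr (_ + _); rewrite -big_split; apply: eq_bigr => j _ /=; ring.
  split => //.
    have := S (0, 1 : R^o); rewrite /= [X in _ + X]big1 => [|j _]; last first.
      by rewrite dotvC dotv0r mulr0.
    by rewrite addr0 => ->; apply: eq_bigr => j _; rewrite dotvC dotv0r subr0 mulr1.
  apply/eqP; rewrite -subr_eq0; apply/eqP/dotv_eq0 => y; rewrite dotvBr !dotv_sumr.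
  have /= := S (y, 0 : R^o).
  rewrite (eq_bigr (fun j => - dotv y (la (inl (inl j)) *: b j))); last first.
    by move=> j _; rewrite dotvZr sub0r mulrN.
  rewrite sumrN; under [X in _ - X]eq_bigr do rewrite dotvZr.
  by move=> /esym; lra.
move=> /existsNP[u /not_implyP[uA /negP]]; rewrite -ltNge => ugt; left; exists u.1; split=> j jP.
  have := uA (inl (inr j)); have := uA (inr j); rewrite !mem_enum => /(_ jP) + /(_ jP).
  by rewrite oppr_le0 => h1 h2; apply/eqP; rewrite eq_le h1 h2.
have := uA (inl (inl j)); rewrite !mem_enum => /(_ jP); rewrite subr_le0.
exact: lt_le_trans.
Qed.

End Dot.

(** * Convex hulls of finite families and their faces *)

Section Hull.
Variables (R : realType) (n : nat) (I : finType).
Implicit Types (x : I -> 'rV[R]_n) (S : {set I}) (a y : 'rV[R]_n) (b : R).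

Definition hull_on x S : set 'rV[R]_n :=
  [set y | exists w : I -> R, [/\ forall i, 0 <= w i, forall i, i \notin S -> w i = 0,
     \sum_i w i = 1 & y = \sum_i w i *: x i]].

Definition hull x : set 'rV[R]_n := hull_on x [set: I]%SET.

(** Index sets of faces. Passing to them turns a combinatorial equivalence into an equality of two
    families of subsets of [I], as in [comb_equiv_facial]. *)
Definition facial x S : Prop :=
  exists a b, (forall i, dotv a (x i) <= b) /\ (forall i, (i \in S) = (dotv a (x i) == b)).

Lemma hull_onS x S1 S2 : {subset S1 <= S2} -> hull_on x S1 `<=` hull_on x S2.
Proof.
move=> sub y [w [w0 wS w1 ->]]; exists w; split => // i iS2; apply: wS.
by apply: contraNN iS2; exact: sub.
Qed.

Lemma hull_on_hull x S : hull_on x S `<=` hull x.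
Proof. by apply: hull_onS => i _; rewrite inE. Qed.

Lemma hull_on_pt x S i : i \in S -> hull_on x S (x i).
Proof.
move=> iS; exists (fun j => (j == i)%:R); split => [j|j||].
- exact: ler0n.
- by case: eqP => // ->; rewrite iS.
- by rewrite (bigD1 i) //= eqxx big1 ?addr0 // => j /negPf->.
- rewrite (bigD1 i) //= eqxx scale1r big1 ?addr0 // => j /negPf->; exact: scale0r.
Qed.

Lemma hull_pt x i : hull x (x i).
Proof. by apply: hull_on_pt; rewrite inE. Qed.

Lemma dotv_gap a b (w : I -> R) x : \sum_i w i = 1 ->
  b - dotv a (\sum_i w i *: x i) = \sum_i w i * (b - dotv a (x i)).
Proof.
move=> w1; rewrite dotv_sumr -[in LHS](mul1r b) -w1 mulr_suml -sumrB.
by apply: eq_bigr => i _; rewrite dotvZr mulrBr.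
Qed.

Lemma hull_le x a b y : (forall i, dotv a (x i) <= b) -> hull x y -> dotv a y <= b.
Proof.
move=> H [w [w0 _ w1 ->]]; rewrite -subr_ge0 dotv_gap //.
by apply: sumr_ge0 => i _; rewrite mulr_ge0 // subr_ge0.
Qed.

(** The gap [b - dotv a y] is the weighted sum of the gaps of the generators, all nonnegative; it
    vanishes exactly when no weight is placed off [S]. *)
Lemma hull_face x a b S : (forall i, dotv a (x i) <= b) ->
  (forall i, (i \in S) = (dotv a (x i) == b)) ->
  hull x `&` [set y | dotv a y = b] = hull_on x S.
Proof.
move=> H HS; apply/seteqP; split => y /=.
  move=> [[w [w0 _ w1 ->]] E]; exists w; split => // i iS.
  have /eqP := dotv_gap a b x w1; rewrite E subrr eq_sym psumr_eq0; last first.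
    by move=> j _; rewrite mulr_ge0 // subr_ge0.
  move=> /allP/(_ i); rewrite mem_index_enum mulf_eq0 subr_eq0 eq_sym => /(_ isT).
  by rewrite [b == _]eq_sym -HS (negPf iS) orbF eq_sym => /eqP.
move=> yS; split; first exact: hull_on_hull yS.
case: yS => w [w0 wS w1 ->]; apply/esym/eqP; rewrite -subr_eq0 dotv_gap // big1 // => i _.
have [|/wS->] := boolP (i \in S); last by rewrite mul0r.
by rewrite HS => /eqP->; rewrite subrr mulr0.
Qed.

Lemma facial_mem x S i : facial x S -> hull_on x S (x i) -> i \in S.
Proof.
move=> [a [b [H HS]]]; rewrite -(hull_face H HS) => -[_ /= E].
by rewrite HS E.
Qed.

Lemma face_facial x F : face (hull x) F -> exists S, facial x S /\ F = hull_on x S.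
Proof.
move=> [a [b [H ->]]].
have Hi i : dotv a (x i) <= b by apply: H; exact: hull_pt.
exists [set i | dotv a (x i) == b]%SET; have HS i : (i \in [set i | dotv a (x i) == b]%SET) =
  (dotv a (x i) == b) by rewrite inE.
by split; [exists a, b | exact: hull_face].
Qed.

Lemma facial_face x S : facial x S -> face (hull x) (hull_on x S).
Proof.
move=> [a [b [H HS]]]; exists a, b; split; first by move=> y; exact: hull_le.
by rewrite -(hull_face H HS).
Qed.

Lemma facialT x : facial x [set: I]%SET.
Proof. by exists 0, 0; split => i; rewrite dotvC dotv0r ?inE ?eqxx. Qed.

Lemma facialI x S1 S2 : facial x S1 -> facial x S2 -> facial x (S1 :&: S2)%SET.
Proof.
move=> [a1 [b1 [H1 E1]]] [a2 [b2 [H2 E2]]]; exists (a1 + a2), (b1 + b2); split=> i.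
  by rewrite dotvDl lerD.
rewrite dotvDl finset.in_setI E1 E2; apply/andP/eqP => [[/eqP-> /eqP->]//|E].
by have := H1 i; have := H2 i; split; apply/eqP; lra.
Qed.

End Hull.

Lemma comb_equiv_facial (R : realType) (I : finType) (n m : nat)
    (x : I -> 'rV[R]_n) (y : I -> 'rV[R]_m) :
  (forall S : {set I}, facial x S <-> facial y S) -> comb_equiv (hull x) (hull y).
Proof.
move=> xy; pose ix (F : set 'rV[R]_n) := [set i | `[< F (x i) >]]%SET.
have ixE S : facial x S -> ix (hull_on x S) = S.
  move=> fS; apply/setP => i; rewrite inE; apply/asboolP/idP => [|iS]; first exact: facial_mem.
  exact: hull_on_pt.
exists (fun F => hull_on y (ix F)); split; [|split].
- move=> F /face_facial[S [fS ->]]; rewrite ixE //; apply: facial_face; exact/xy.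
- move=> G /face_facial[S [fS ->]]; exists (hull_on x S).
  have fxS : facial x S by apply/xy.
  by rewrite ixE //; split => //; exact: facial_face.
- move=> F1 F2 /face_facial[S1 [fS1 ->]] /face_facial[S2 [fS2 ->]]; rewrite !ixE //.
  split => sub; apply: hull_onS => i iS.
    by apply: (facial_mem fS2); apply: sub; exact: hull_on_pt.
  have fyS2 : facial y S2 by apply/xy.
  by apply: (facial_mem fyS2); apply: sub; exact: hull_on_pt.
Qed.

Lemma conv_hull (R : realType) (n k : nat) (s : seq 'rV[R]_n) :
  size s = k -> conv s = hull (fun i : 'I_k => s`_i).
Proof.
case: k /; apply/seteqP; split => y.
  by move=> [w [w0 [w1 ->]]]; exists w; split => // i; rewrite inE.
by move=> [w [w0 _ w1 ->]]; exists w.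
Qed.

(** Product weights give one inclusion, marginals of the weights the other. *)
Lemma minkowski_hull (R : realType) (n : nat) (I A B : finType) (g1 : I -> A) (g2 : I -> B)
    (u : A -> 'rV[R]_n) (v : B -> 'rV[R]_n) :
  injective (fun i => (g1 i, g2 i)) -> (forall a b, exists i, g1 i = a /\ g2 i = b) ->
  minkowski (hull u) (hull v) = hull (fun i => u (g1 i) + v (g2 i)).
Proof.
move=> ginj gsurj.
have gbij : bijective (fun i => (g1 i, g2 i)).
  apply: inj_card_bij => //; rewrite -(card_codom ginj); apply: subset_leq_card.
  apply/fintype.subsetP => -[a b] _; have [i [<- <-]] := gsurj a b; exact: codom_f.
have gon : {on (fun _ => true), bijective (fun i => (g1 i, g2 i))} by exact: onW_bij.
have sumE (V : zmodType) (F : A -> B -> V) :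
    \sum_i F (g1 i) (g2 i) = \sum_a \sum_b F a b.
  by rewrite pair_bigA /= (reindex (fun i => (g1 i, g2 i))).
apply/seteqP; split => y.
  move=> [_ [_ [[w [w0 _ w1 ->]] [[w' [w'0 _ w'1 ->]] ->]]]].
  exists (fun i => w (g1 i) * w' (g2 i)); split.
  - by move=> i; rewrite mulr_ge0.
  - by move=> i; rewrite inE.
  - rewrite (sumE _ (fun a b => w a * w' b)) -w1; apply: eq_bigr => a _.
    by rewrite -mulr_sumr w'1 mulr1.
  rewrite (sumE _ (fun a b => (w a * w' b) *: (u a + v b))).
  under [RHS]eq_bigr => a _ do
    (under eq_bigr => b _ do rewrite scalerDr; rewrite big_split /=).
  rewrite big_split /=; congr (_ + _).
    apply: eq_bigr => a _; rewrite -scaler_suml -mulr_sumr w'1 mulr1 //.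
  rewrite exchange_big; apply: eq_bigr => b _.
  by rewrite -scaler_suml -mulr_suml w1 mul1r.
move=> [w [w0 _ w1 ->]].
have wE (V : zmodType) (F : I -> V) : \sum_a \sum_(i | g1 i == a) F i = \sum_i F i.
  by rewrite (partition_big g1 xpredT).
have wE' (V : zmodType) (F : I -> V) : \sum_b \sum_(i | g2 i == b) F i = \sum_i F i.
  by rewrite (partition_big g2 xpredT).
exists (\sum_i w i *: u (g1 i)), (\sum_i w i *: v (g2 i)); split; [|split].
- exists (fun a => \sum_(i | g1 i == a) w i); split.
  + by move=> a; apply: sumr_ge0.
  + by move=> a; rewrite inE.
  + by rewrite wE.
  rewrite -wE; apply: eq_bigr => a _; rewrite scaler_suml; apply: eq_bigr => i /eqP-> //.
- exists (fun b => \sum_(i | g2 i == b) w i); split.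
  + by move=> a; apply: sumr_ge0.
  + by move=> a; rewrite inE.
  + by rewrite wE'.
  rewrite -wE'; apply: eq_bigr => a _; rewrite scaler_suml; apply: eq_bigr => i /eqP-> //.
by rewrite -big_split; apply: eq_bigr => i _; rewrite scalerDr.
Qed.

Definition grid_set (I A B : finType) (g1 : I -> A) (g2 : I -> B) (S : {set I}) : Prop :=
  exists (X : {set A}) (Y : {set B}), forall i, (i \in S) = (g1 i \in X) && (g2 i \in Y).

(** * The faces of Delta *)

Section Delta.
Variables (R : realType) (I : finType) (p q : nat) (g1 : I -> 'I_p.+1) (g2 : I -> 'I_q.+1).
Hypothesis g_inj : injective (fun i => (g1 i, g2 i)).
Hypothesis g_surj : forall a b, exists i, g1 i = a /\ g2 i = b.

Definition lvertex (a : 'I_p.+1) : 'rV[R]_(p + q) :=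
  (0 :: [seq delta_mx 0 (lshift q i) | i : 'I_p])`_a.
Definition rvertex (b : 'I_q.+1) : 'rV[R]_(p + q) :=
  (0 :: [seq delta_mx 0 (rshift p j) | j : 'I_q])`_b.
Definition Delta_vertex i := lvertex (g1 i) + rvertex (g2 i).

Lemma Delta_hull : Delta R p q = hull Delta_vertex.
Proof.
rewrite /Delta (@conv_hull _ _ p.+1) /= ?size_image ?card_ord //.
rewrite (@conv_hull _ _ q.+1) /= ?size_image ?card_ord //.
exact: minkowski_hull.
Qed.

(** Exchanging coordinates between two vertices preserves the sum of their values, so if both are
    maximal the exchanged vertices are too. In the other direction, a functional whose values are
    the indicators of [X] and [Y] up to constants is maximal on the product. *)
Lemma Delta_facial S : facial Delta_vertex S <-> grid_set g1 g2 S.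
Proof.
split=> [[c [b [H HS]]]|[X [Y HS]]].
  exists [set g1 i | i in S]%SET, [set g2 i | i in S]%SET => i.
  apply/idP/andP => [iS|[/imsetP[j jS Ej] /imsetP[k kS Ek]]]; first by rewrite !imset_f.
  have [l [l1 l2]] := g_surj (g1 k) (g2 j).
  move: jS kS (H i) (H l); rewrite !HS /Delta_vertex !dotvDr l1 l2 Ej Ek => /eqP h1 /eqP h2 h3 h4.
  by apply/eqP; lra.
have nth_l (i : 'I_p) : lvertex (lift ord0 i) = delta_mx 0 (lshift q i).
  by rewrite /lvertex lift0 /= (nth_map i) ?size_enum_ord // nth_ord_enum.
have nth_r (j : 'I_q) : rvertex (lift ord0 j) = delta_mx 0 (rshift p j).
  by rewrite /rvertex lift0 /= (nth_map j) ?size_enum_ord // nth_ord_enum.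
(* The vertex numbered [ord0] is the origin, where every functional is 0, so the indicators are
   shifted to vanish there. *)
pose al (a : 'I_p.+1) : R := (a \in X)%:R - (ord0 \in X)%:R.
pose be (b : 'I_q.+1) : R := (b \in Y)%:R - (ord0 \in Y)%:R.
pose c : 'rV[R]_(p + q) := row_mx (\row_i al (lift ord0 i)) (\row_j be (lift ord0 j)).
have dotd k : dotv c (delta_mx 0 k) = c 0 k.
  rewrite /dotv (bigD1 k) //= big1 ?addr0 ?mxE ?eqxx ?mulr1 // => j jk.
  by rewrite [delta_mx _ _ _ _]mxE (negPf jk) andbF mulr0.
have cl a : dotv c (lvertex a) = al a.
  have [i ->|->] := unliftP ord0 a; first by rewrite nth_l dotd row_mxEl mxE.
  by rewrite /lvertex /= dotv0r /al subrr.
have cr b : dotv c (rvertex b) = be b.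
  have [i ->|->] := unliftP ord0 b; first by rewrite nth_r dotd row_mxEr mxE.
  by rewrite /rvertex /= dotv0r /be subrr.
exists c, (1 - (ord0 \in X)%:R + (1 - (ord0 \in Y)%:R)); split=> i.
  rewrite dotvDr cl cr /al /be lerD // lerD2r; by case: (_ \in _).
rewrite dotvDr cl cr /al /be HS.
have -> (e f u v : R) : (e - f + (u - v) == 1 - f + (1 - v)) = (e + u == 2).
  by apply/eqP/eqP; lra.
by case: (_ \in X); case: (_ \in Y) => /=; apply/esym/eqP; lra.
Qed.

End Delta.

(** * Vertices and adjacency *)

Section Vertices.
Variables (R : realType) (n : nat) (I : finType) (x : I -> 'rV[R]_n).
Hypothesis exposed : forall i, exists a, forall j, j != i -> dotv a (x j) < dotv a (x i).
Implicit Types (i j k l u v w : I) (a : 'rV[R]_n).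

(* Locked because [inE] would otherwise turn adjacency into its defining proposition. *)
Definition vadj : rel I := locked (fun i j =>
  `[< i <> j /\ exists a, dotv a (x i) = dotv a (x j) /\
        forall k, k != i -> k != j -> dotv a (x k) < dotv a (x i) >]).

Lemma vadjP i j : reflect (i <> j /\ exists a, dotv a (x i) = dotv a (x j) /\
  forall k, k != i -> k != j -> dotv a (x k) < dotv a (x i)) (vadj i j).
Proof. by rewrite /vadj -lock; exact: asboolP. Qed.

Lemma vadjC : symmetric vadj.
Proof.
have imp i j : vadj i j -> vadj j i.
  move=> /vadjP[ij [a [E H]]]; apply/vadjP; split; first exact: nesym.
  by exists a; split => // k kj ki; rewrite -E; exact: H.
by move=> i j; apply/idP/idP; exact: imp.
Qed.

Lemma vadj_irr : irreflexive vadj.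
Proof. by move=> i; apply/vadjP => -[]. Qed.

(** Such a relation writes [x i] as a convex combination of [x j] and [x k], against the functional
    exposing [x i]. *)
Lemma dependence_sign i j k (ci cj ck : R) : i != j -> i != k ->
  ci + cj + ck = 0 -> ci *: x i + cj *: x j + ck *: x k = 0 ->
  0 < ci -> cj <= 0 -> ck <= 0 -> False.
Proof.
move=> ij ik sum0 comb0 ci0 cj0 ck0; have [a Ha] := exposed i.
have h1 : dotv a (x j) < dotv a (x i) by apply: Ha; rewrite eq_sym.
have h2 : dotv a (x k) < dotv a (x i) by apply: Ha; rewrite eq_sym.
have E : cj * (dotv a (x j) - dotv a (x i)) + ck * (dotv a (x k) - dotv a (x i)) = 0.
  have := congr1 (dotv a) comb0; rewrite !dotvDr !dotvZr dotv0r => <-.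
  have -> : ci = - cj - ck by lra.
  ring.
have p1 : 0 <= cj * (dotv a (x j) - dotv a (x i)) by rewrite mulr_le0 // subr_le0 ltW.
have p2 : 0 <= ck * (dotv a (x k) - dotv a (x i)) by rewrite mulr_le0 // subr_le0 ltW.
have [cjn|cjz] := ltP cj 0.
  by have : 0 < cj * (dotv a (x j) - dotv a (x i)); [rewrite nmulr_rgt0 // subr_lt0 | lra].
have ckn : ck < 0 by lra.
by have : 0 < ck * (dotv a (x k) - dotv a (x i)); [rewrite nmulr_rgt0 // subr_lt0 | lra].
Qed.

Lemma not_collinear i j k (c1 c2 : R) : i != j -> j != k -> i != k ->
  c1 *: (x i - x j) + c2 *: (x j - x k) = 0 -> c1 = 0 /\ c2 = 0.
Proof.
move=> ij jk ik E.
have ji : j != i by rewrite eq_sym.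
have kj : k != j by rewrite eq_sym.
have ki : k != i by rewrite eq_sym.
have comb (e : R) : (e * c1) *: x i + (e * (c2 - c1)) *: x j + (e * - c2) *: x k = 0.
  rewrite -[RHS](scaler0 _ e) -E; apply/rowP => l; rewrite !mxE; ring.
have := comb 1; have := comb (-1); rewrite !mul1r !mulN1r => E1 E2.
have H0 i' j' k' (ci cj ck : R) : i' != j' -> i' != k' -> ci + cj + ck = 0 ->
    ci *: x i' + cj *: x j' + ck *: x k' = 0 -> 0 < ci -> cj <= 0 -> ck <= 0 -> False.
  exact: dependence_sign.
have A1 := H0 _ _ _ _ _ _ ij ik _ E1; have A2 := H0 _ _ _ _ _ _ ij ik _ E2.
rewrite (addrC (_ *: x i)) in E1; rewrite (addrC (_ *: x i)) in E2.
have B1 := H0 _ _ _ _ _ _ ji jk _ E1; have B2 := H0 _ _ _ _ _ _ ji jk _ E2.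
rewrite [LHS]addrC addrA in E1; rewrite [LHS]addrC addrA in E2.
have C1 := H0 _ _ _ _ _ _ kj ki _ E1; have C2 := H0 _ _ _ _ _ _ kj ki _ E2.
have [c1p|c1n|c10] := ltgtP c1 0; last first; first split => //.
- have [c2p|c2n|//] := ltgtP c2 0; [case: C2|case: B2]; lra.
- have [c12|c12] := leP c2 c1; last by case: C1; lra.
  by have [c2p|c2n] := leP c2 0; [case: B1 | case: A2]; lra.
- have [c12|c12] := leP c1 c2; last by case: C2; lra.
  by have [c2p|c2n] := leP 0 c2; [case: B2 | case: A1]; lra.
Qed.

(** The alternative to a functional exposing the segment from [x i] to [x j] is a combination of the
    other directions equal to a multiple [t j] of this one; the functional exposing [x i] shows that
    [t j] is positive. *)
Lemma not_adj_cone i j : i != j -> ~~ vadj i j ->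
  exists nu : I -> R, [/\ forall k, 0 <= nu k, nu i = 0, nu j = 0 &
    x j - x i = \sum_k nu k *: (x k - x i)].
Proof.
move=> ij nadj; pose Q := [pred k | (k != i) && (k != j)].
have [[a [Ea Ha]]|[mu [t [mu0 mu1 Emu]]]] :=
  motzkin Q (pred1 j) (fun k => x i - x k) (fun k => x i - x k).
  case/negP: nadj; apply/vadjP; split; first exact/eqP.
  exists a; split; first by have /eqP := Ea j (eqxx j); rewrite dotvBr subr_eq0 => /eqP.
  by move=> k ki kj; have := Ha k; rewrite /Q inE ki kj dotvBr subr_gt0; apply.
rewrite big_pred1_eq in Emu; have [a Ha] := exposed i.
have gt k : k != i -> 0 < dotv a (x i - x k) by move=> /Ha; rewrite dotvBr subr_gt0.
have t_gt0 : 0 < t j.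
  have : 0 < dotv a (\sum_(k | Q k) mu k *: (x i - x k)).
    rewrite dotv_sumr lt_neqAle eq_sym; apply/andP; split; last first.
      apply: sumr_ge0 => k /andP[ki _]; rewrite dotvZr mulr_ge0 //; exact/ltW/gt.
    apply/negP; rewrite psumr_eq0 => [|k /andP[ki _]]; last first.
      by rewrite dotvZr mulr_ge0 //; exact/ltW/gt.
    move=> /allP all0; have /eqP := mu1; rewrite big1 => [|k Qk].
      by rewrite eq_sym oner_eq0.
    have := all0 k (mem_index_enum _); rewrite Qk dotvZr mulf_eq0 => /orP[/eqP//|].
    by move: Qk => /andP[/gt ki _]; rewrite gt_eqF.
  by rewrite Emu dotvZr pmulr_lgt0 // gt // eq_sym.
exists (fun k => if Q k then mu k / t j else 0); split.
- by move=> k; case: ifP => // _; rewrite divr_ge0 // ltW.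
- by rewrite /Q /= eqxx.
- by rewrite /Q /= eqxx andbF.
transitivity ((t j)^-1 *: (\sum_(k | Q k) mu k *: (x k - x i))).
  under eq_bigr do rewrite -(opprB (x i)) scalerN.
  by rewrite sumrN Emu -scalerN opprB scalerA mulVf ?scale1r // gt_eqF.
rewrite scaler_sumr big_mkcond; apply: eq_bigr => k _; case: ifP; rewrite ?scale0r //.
by rewrite scalerA mulrC.
Qed.

Definition generates i (U : {set I}) : Prop := i \notin U /\
  forall k, exists c : I -> R, [/\ forall l, 0 <= c l, forall l, l \notin U -> c l = 0 &
    x k - x i = \sum_l c l *: (x l - x i)].

Lemma generates_all i : generates i [set~ i]%SET.
Proof.
split => [|k]; first by rewrite !inE eqxx.
exists (fun l => ((l == k) && (l != i))%:R); split => [l|l|].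
- exact: ler0n.
- by rewrite !inE negbK => ->; rewrite andbF.
have [->|ki] := eqVneq k i.
  by rewrite subrr big1 // => l _; case: eqP; rewrite /= scale0r.
rewrite (bigD1 k) //= eqxx ki scale1r big1 ?addr0 // => l /negPf->.
exact: scale0r.
Qed.

(** In a generating set of least size every member is adjacent to [i]. Otherwise [not_adj_cone],
    expanded again over the generators, expresses the direction of [u] with coefficient [g u] on
    itself; if [g u < 1] one solves for it and discards [u]. *)
Lemma cone_nb i k : exists c : I -> R, [/\ forall l, 0 <= c l, forall l, ~~ vadj i l -> c l = 0 &
    x k - x i = \sum_l c l *: (x l - x i)].
Proof.
have [U gU minU] : exists2 U, generates i U & forall U', generates i U' -> (#|U| <= #|U'|)%N.
  case: (arg_minnP (P := fun U => `[< generates i U >]) (fun U : {set I} => #|U|)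
    (i0 := [set~ i]%SET)); first exact/asboolP/generates_all.
  by move=> U /asboolP gU min; exists U => // U' gU'; apply: min; exact/asboolP.
suff adjU u : u \in U -> vadj i u.
  have [c [c0 cU E]] := gU.2 k; exists c; split => // l; move=> il; apply: cU.
  by apply: contraNN il; exact: adjU.
move=> uU; apply: contraT => nadj.
have iU : i \notin U := gU.1.
have ui : u != i by apply: contraNneq iU => <-.
have iu : i != u by rewrite eq_sym.
have [nu [nu0 nui nuu Enu]] := not_adj_cone iu nadj.
have [C HC] := choice gU.2.
pose g l := \sum_m nu m * C m l.
have g0 l : 0 <= g l by apply: sumr_ge0 => m _; rewrite mulr_ge0 //; case: (HC m).
have gU0 l : l \notin U -> g l = 0.
  by move=> lU; rewrite /g big1 // => m _; case: (HC m) => _ -> //; rewrite mulr0.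
have Eu : x u - x i = \sum_l g l *: (x l - x i).
  rewrite Enu; under eq_bigr => m _ do (have [_ _ ->] := HC m; rewrite scaler_sumr).
  rewrite exchange_big; apply: eq_bigr => l _; rewrite scaler_suml.
  by apply: eq_bigr => m _; rewrite scalerA.
have [gu1|gu1] := ltP (g u) 1.
  have gu1' : 1 - g u != 0 by rewrite subr_eq0 eq_sym lt_eqF.
  have Eu' : x u - x i = \sum_(l | l != u) (g l / (1 - g u)) *: (x l - x i).
    transitivity ((1 - g u)^-1 *: ((1 - g u) *: (x u - x i))).
      by rewrite scalerA mulVf // scale1r.
    rewrite scalerBl scale1r [in X in _ *: (X - _)]Eu (bigD1 u) //= addrAC subrr add0r scaler_sumr.
    by apply: eq_bigr => l _; rewrite scalerA mulrC.
  suff : generates i (U :\ u)%SET.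
    by move=> /minU; rewrite [#|U|](cardsD1 u) uU ltnn.
  split => [|m]; first by rewrite finset.in_setD1 (negPf iU) andbF.
  have [c0 cU Em] := HC m.
  exists (fun l => if l == u then 0 else C m l + C m u * (g l / (1 - g u))); split.
  - move=> l; case: ifP => // _; rewrite addr_ge0 // mulr_ge0 // divr_ge0 // subr_ge0.
    exact: ltW.
  - move=> l; rewrite finset.in_setD1; case: eqP => //= _ lU.
    by rewrite cU // gU0 // mul0r mulr0 addr0.
  rewrite Em (bigD1 u) //= [RHS](bigD1 u) //= eqxx scale0r add0r Eu' scaler_sumr -big_split.
  by apply: eq_bigr => l /negPf->; rewrite /= addrC scalerDl scalerA.
(* Now [g u >= 1]. The functional exposing [x i] forces all other coefficients to vanish, so some
   [x m] other than [x u] lies on the line through [x i] and [x u]. *)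
have [a Ha] := exposed i.
have gt l : l != i -> 0 < dotv a (x i - x l) by move=> /Ha; rewrite dotvBr subr_gt0.
have Ea : dotv a (x i - x u) = \sum_l g l * dotv a (x i - x l).
  rewrite -opprB Eu -sumrN dotv_sumr; apply: eq_bigr => l _.
  by rewrite -scalerN opprB dotvZr.
have gge0 l : 0 <= g l * dotv a (x i - x l).
  have [->|li] := eqVneq l i; first by rewrite subrr dotv0r mulr0.
  by rewrite mulr_ge0 //; exact/ltW/gt.
have rest0 : \sum_(l | l != u) g l * dotv a (x i - x l) = 0.
  have r0 : 0 <= \sum_(l | l != u) g l * dotv a (x i - x l) by exact: sumr_ge0.
  have := gt u ui; move: Ea; rewrite (bigD1 u) //=; nra.
have gl0 l : l != u -> g l = 0.
  move=> lu; have [->|li] := eqVneq l i; first exact: gU0.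
  have /eqP := rest0; rewrite psumr_eq0 // => /allP/(_ l (mem_index_enum _)).
  by rewrite lu mulf_eq0 (gt_eqF (gt l li)) orbF => /eqP.
have [m num] : exists m, nu m != 0.
  apply: contrapT => /forallNP none; have := gt u ui.
  rewrite -opprB Enu big1 ?oppr0 ?dotv0r ?ltxx //.
  by move=> m _; have /negP/negPn/eqP-> := none m; rewrite scale0r.
have mi : m != i by apply: contraNneq num => ->; rewrite nui.
have mu : m != u by apply: contraNneq num => ->; rewrite nuu.
have Cm l : l != u -> C m l = 0.
  move=> /gl0/eqP; rewrite psumr_eq0 => [|m' _]; last by rewrite mulr_ge0 //; case: (HC m').
  by move=> /allP/(_ m (mem_index_enum _)); rewrite mulf_eq0 (negPf num) => /eqP.
have [_ _ Em] := HC m.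
have : 1 *: (x m - x i) + C m u *: (x i - x u) = 0.
  rewrite scale1r Em (bigD1 u) //= big1 ?addr0; last by move=> l /Cm->; rewrite scale0r.
  by rewrite -scalerDr addrA subrK subrr scaler0.
by case/(not_collinear mi iu mu) => /eqP; rewrite oner_eq0.
Qed.

Lemma adj_improve a i k : dotv a (x i) < dotv a (x k) ->
  exists2 l, vadj i l & dotv a (x i) < dotv a (x l).
Proof.
move=> ik; have [c [c0 cN E]] := cone_nb i k.
apply: contrapT => none; move: ik; rewrite -subr_gt0 -dotvBr E dotv_sumr ltNge => /negP[].
apply: sumr_le0 => l _; rewrite dotvZr; have [il|/cN->] := boolP (vadj i l); last by rewrite mul0r.
rewrite mulr_ge0_le0 // dotvBr subr_le0 leNgt; apply/negP => lt; apply: none; by exists l.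
Qed.

Lemma vadj_connected (S : pred I) i0 : S i0 -> (forall i j, S i -> vadj i j -> S j) ->
  forall w, S w.
Proof.
move=> S0 clos w; have [a Ha] := exposed w.
case: (arg_maxP (fun i => dotv a (x i)) S0) => i Si imax.
have [<-//|iw] := eqVneq i w.
have [l il lt] := adj_improve (Ha i iw).
have le : dotv a (x l) <= dotv a (x i) by exact: imax (clos _ _ Si il).
by rewrite leNgt lt in le.
Qed.

End Vertices.

(** * Degrees, planar quadrilaterals and facets *)

Lemma aff_indep_span (R : realType) (n : nat) (s0 : 'rV[R]_n) (t X : seq 'rV[R]_n) :
  aff_indep (s0 :: t) -> (forall y, y \in t -> y - s0 \in <<X>>%VS) -> (size t <= size X)%N.
Proof.
move=> indep sub; pose T := [tuple of [seq y - s0 | y <- in_tuple t]].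
have fT : free T.
  apply/freeP => c; rewrite (eq_bigr (fun i => c i *: (t`_(val i) - s0))) => [/indep//|i _].
  by rewrite /T /= (nth_map 0).
have <- : \dim <<T>>%VS = size t by move/eqP: fT => ->; rewrite size_tuple.
apply: leq_trans (dim_span X); apply: dimvS; apply/span_subvP => _ /mapP[y yt ->].
exact: sub.
Qed.

Section Dimension.
Variables (R : realType) (n d : nat) (I : finType) (x : I -> 'rV[R]_n).
Hypothesis exposed : forall i, exists a, forall j, j != i -> dotv a (x j) < dotv a (x i).
Hypothesis dim_ge : exists s : seq 'rV[R]_n,
  size s = d.+1 /\ (forall y, y \in s -> hull x y) /\ aff_indep s.
Implicit Types (i j k l u v w : I) (a : 'rV[R]_n) (X : seq 'rV[R]_n).
Local Notation adj := (vadj x).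
Local Notation nb := (nb adj).

(** By [cone_nb] the edge directions at one vertex already span the direction space of the whole
    hull. *)
Lemma dim_le_span v X : (forall k, adj v k -> x k - x v \in <<X>>%VS) -> (d <= size X)%N.
Proof.
move=> sub; have [[|s0 t] [// [szs] [sP indep]]] := dim_ge.
have inX y : hull x y -> y - x v \in <<X>>%VS.
  move=> [w [w0 _ w1 ->]]; rewrite -[x v]scale1r -w1 scaler_suml -sumrB.
  apply: rpred_sum => k _; rewrite -scalerBr rpredZ //.
  have [c [_ cN ->]] := cone_nb exposed v k; apply: rpred_sum => l _.
  by have [/sub|/cN->] := boolP (adj v l); [exact: rpredZ | rewrite scale0r rpred0].
rewrite -szs; apply: aff_indep_span indep _ => y yt.
rewrite -(subrKA (x v)) -[x v - s0]opprB rpredB // inX //; apply: sP; rewrite inE ?eqxx //.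
by rewrite yt orbT.
Qed.

Lemma span_diff (T : {set I}) v k : k \in T ->
  x k - x v \in <<[seq x l - x v | l <- enum T]>>%VS.
Proof. by move=> kT; apply: memv_span; apply: map_f; rewrite mem_enum. Qed.

Lemma degree_ge v : (d <= #|nb v|)%N.
Proof.
rewrite cardE -(size_map (fun k => x k - x v)); apply: (@dim_le_span v) => k vk.
by apply: span_diff; rewrite inE.
Qed.

Section Common.
Variable q : I -> 'rV[R]_n.
Definition lmeet (s : R) : rel I := fun i j => q i - s *: x i == q j - s *: x j.

Lemma lmeetE s i j : lmeet s i j = (q i - q j == s *: (x i - x j)).
Proof. by apply/eqP/eqP => /rowP E; apply/rowP => l; have := E l; rewrite !mxE; lra. Qed.

Lemma lmeet_refl s : reflexive (lmeet s).
Proof. by move=> i; exact: eqxx. Qed.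

Lemma lmeetC s : symmetric (lmeet s).
Proof. by move=> i j; exact: eq_sym. Qed.

Lemma lmeet_trans s : transitive (lmeet s).
Proof. by move=> j i k /eqP ij /eqP jk; apply/eqP; rewrite ij. Qed.

Lemma vertex_inj : injective x.
Proof.
move=> i j E; apply/eqP; apply: contraT => ij; have [a /(_ j)] := exposed i.
by rewrite eq_sym ij E ltxx => /(_ isT).
Qed.

Lemma lmeet_uniq s t i j : i != j -> lmeet s i j -> lmeet t i j -> s = t.
Proof.
move=> ij; rewrite !lmeetE => /eqP -> /eqP/eqP; rewrite -subr_eq0 -scalerBl scaler_eq0 !subr_eq0.
by rewrite (inj_eq vertex_inj) (negPf ij) orbF => /eqP.
Qed.

Lemma lmeet_triangle s t r i j k : i != j -> j != k -> i != k ->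
  lmeet s i j -> lmeet t j k -> lmeet r i k -> s = t.
Proof.
rewrite !lmeetE => ij jk ik /eqP Es /eqP Et /eqP Er.
have : (s - r) *: (x i - x j) + (t - r) *: (x j - x k) = 0.
  have : s *: (x i - x j) + t *: (x j - x k) = r *: (x i - x k).
    by rewrite -Es -Et -Er addrA subrK.
  by move=> /rowP E; apply/rowP => l; have := E l; rewrite !mxE; lra.
by case/(not_collinear exposed ij jk ik) => sr tr; lra.
Qed.

(* The four lines closing up a quadrilateral [v b a b'] force its vertices to be coplanar. *)
Lemma lmeet_plane v (a b b' : I) s1 s2 s3 s4 : (forall s, ~~ lmeet s v a) ->
  lmeet s1 v b -> lmeet s2 b a -> lmeet s3 b' a -> lmeet s4 v b' ->
  x b' - x v \in <<[:: x b - x v; x a - x v]>>%VS.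
Proof.
move=> nva m1 m2 m3 m4.
have s34 : s4 - s3 != 0.
  apply/negP; rewrite subr_eq0 => /eqP E; case/negP: (nva s4).
  by apply: lmeet_trans m4 _; rewrite E.
have E : (s4 - s3) *: (x b' - x v) = (s1 - s2) *: (x b - x v) + (s2 - s3) *: (x a - x v).
  move: m1 m2 m3 m4; rewrite !lmeetE => /eqP/rowP m1 /eqP/rowP m2 /eqP/rowP m3 /eqP/rowP m4.
  apply/rowP => l; have := m1 l; have := m2 l; have := m3 l; have := m4 l; rewrite !mxE; lra.
have -> : x b' - x v = (s4 - s3)^-1 *: ((s4 - s3) *: (x b' - x v)).
  by rewrite scalerA mulVf // scale1r.
rewrite E rpredZ // rpredD // rpredZ // memv_span // !inE eqxx ?orbT //.
Qed.

Hypothesis adj_meet : forall i j, adj i j -> exists s, lmeet s i j.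

(** All common neighbours lie in the plane through [x v], [x b] and [x a], so they contribute two
    dimensions at most; the neighbours of [v] not adjacent to [a] must supply the remaining
    [d - 2]. *)
Lemma common_nb_le v (a : I) : (forall s, ~~ lmeet s v a) ->
  (#|nb v :&: nb a| + d <= #|nb v| + 2)%N.
Proof.
move=> nva; have [E|/set0Pn[b /setIP[]]] := eqVneq (nb v :&: nb a)%SET finset.set0.
  by rewrite E cards0 add0n (leq_trans (degree_ge v)) ?leq_addr.
rewrite !inE => vb ab.
have [s1 m1] := adj_meet vb; have [s2 m2] := adj_meet ab; rewrite lmeetC in m2.
pose X := [:: x b - x v; x a - x v] ++ [seq x k - x v | k <- enum (nb v :\: nb a)%SET].
have : (d <= size X)%N.
  apply: (@dim_le_span v) => k vk; rewrite span_cat.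
  have [ak|ak] := boolP (adj a k).
    have [s4 m4] := adj_meet vk; have [s3 m3] := adj_meet ak; rewrite lmeetC in m3.
    by rewrite (subvP (addvSl _ _)) // (lmeet_plane nva m1 m2 m3 m4).
  by rewrite (subvP (addvSr _ _)) // span_diff // !inE vk ak.
rewrite size_cat size_map -cardE /= -(cardsID (nb a) (nb v)) addnC => le.
by rewrite -addnA leq_add2l.
Qed.

End Common.

(** Since the [d] edges at [v] are independent, some functional is constant along all of them but
    the one to [w], where it decreases. By [adj_improve] it is maximal at [v], and [F] is its set of
    maximisers. *)
Lemma simple_facet : (forall v, #|nb v| = d) -> forall v w, adj v w ->
  exists F : {set I}, facial x F /\ [/\ v \in F, w \notin F,
    forall k, adj v k -> k != w -> k \in F & forall u, u \in F -> #|(nb u :\: F)%SET| = 1%N].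
Proof.
move=> reg v w vw; pose E := [pred k | adj v k && (k != w)].
have [[a [Ea Ha]]|[mu [t [_ mu1 Emu]]]] :=
  motzkin (pred1 w) E (fun k => x v - x k) (fun k => x k - x v); last first.
  pose X := [seq x k - x v | k <- enum (nb v :\ w)%SET].
  have : (d <= size X)%N.
    have XE k : E k -> x k - x v \in <<X>>%VS.
      by move=> /andP[vk kw]; rewrite span_diff // !inE kw vk.
    apply: (@dim_le_span v) => k vk; have [->|kw] := eqVneq k w; last by apply: XE; rewrite inE vk.
    move: Emu; rewrite !big_pred1_eq in mu1 *; rewrite mu1 scale1r => Ew.
    rewrite -opprB Ew rpredN rpred_sum // => l El; rewrite rpredZ //; exact: XE.
  by rewrite size_map -cardE -(reg v) [#|nb v|](cardsD1 w) inE vw ltnn.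
have aw : dotv a (x w) < dotv a (x v) by have := Ha w (eqxx w); rewrite dotvBr subr_gt0.
have ak k : adj v k -> k != w -> dotv a (x k) = dotv a (x v).
  move=> vk kw; have := Ea k; rewrite inE vk kw dotvBr => /(_ isT)/eqP.
  by rewrite subr_eq0 => /eqP.
have amax k : dotv a (x k) <= dotv a (x v).
  rewrite leNgt; apply/negP => /(adj_improve exposed)[l vl].
  by have [->|/(ak l vl)->] := eqVneq l w; rewrite ?ltxx // ltNge (ltW aw).
exists [set k | dotv a (x k) == dotv a (x v)]%SET; split.
  by exists a, (dotv a (x v)); split => // k; rewrite inE.
split.
- by rewrite inE.
- by rewrite inE lt_eqF.
- by move=> k vk kw; rewrite inE ak.
set F := [set k | _]%SET => u uF; apply/eqP; rewrite eqn_leq; apply/andP; split.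
  (* The directions from [u] inside [F] span [F], which contains all neighbours of [v] but [w].
     Adding the direction of [w] spans everything, so [u] has at least [d - 1] neighbours in [F]. *)
  pose X := x w - x v :: [seq x k - x u | k <- enum (nb u :&: F)%SET].
  have : (d <= size X)%N.
    apply: (@dim_le_span v) => k vk; rewrite span_cons.
    have [->|kw] := eqVneq k w; first by rewrite (subvP (addvSl _ _)) // memv_line.
    rewrite (subvP (addvSr _ _)) //.
    have inX l : l \in F -> x l - x u \in <<[seq x k - x u | k <- enum (nb u :&: F)%SET]>>%VS.
      move=> lF; have [c [c0 cN El]] := cone_nb exposed u l.
      have : \sum_m c m * (dotv a (x v) - dotv a (x m)) = 0.
        have := congr1 (dotv a) El; rewrite dotvBr dotv_sumr.
        move: lF uF; rewrite !inE => /eqP-> /eqP Eu; rewrite Eu subrr => /esym E0.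
        rewrite -[RHS]oppr0 -[X in _ = - X]E0 -sumrN; apply: eq_bigr => m _.
        by rewrite dotvZr dotvBr Eu -mulrN opprB.
      move=> /eqP; rewrite psumr_eq0 => [/allP c00|m _]; last by rewrite mulr_ge0 // subr_ge0.
      rewrite El; apply: rpred_sum => m _.
      have [um|/cN->] := boolP (adj u m); last by rewrite scale0r rpred0.
      have := c00 m (mem_index_enum _); rewrite mulf_eq0 => /orP[/eqP->|].
        by rewrite scale0r rpred0.
      rewrite subr_eq0 eq_sym => am; by rewrite rpredZ // span_diff // !inE um am.
    rewrite -(subrKA (x u)) -[x u - x v]opprB rpredB // inX // inE ?ak //.
  rewrite /= size_map -cardE -(reg u) -(cardsID F (nb u)).
  by rewrite -addn1 leq_add2l.
have [l ul al] : exists2 l, adj u l & l \notin F.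
  have [l ul lt] : exists2 l, adj u l & dotv (- a) (x u) < dotv (- a) (x l).
    apply: (adj_improve exposed (k := w)); rewrite !dotvNl ltrN2.
    by move: uF; rewrite inE => /eqP->.
  exists l => //; rewrite inE lt_eqF //; move: uF; rewrite inE => /eqP <-.
  by move: lt; rewrite !dotvNl ltrN2.
by rewrite card_gt0; apply/set0Pn; exists l; rewrite !inE ul andbT; move: al; rewrite inE.
Qed.

Lemma facial_preim (A : finType) (g : I -> A) :
  (forall a : A, facial x [set i | g i != a]%SET) ->
  forall X : {set A}, facial x [set i | g i \in X]%SET.
Proof.
move=> H X.
have Hr (r : seq A) : facial x [set i | g i \notin r]%SET.
  elim: r => [|a r IH].
    by have := facialT x; congr facial; apply/setP => i; rewrite !inE.
  have := facialI (H a) IH; congr facial; apply/setP => i.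
  by rewrite !inE negb_or.
have := Hr (enum (~: X)%SET); congr facial; apply/setP => i.
by rewrite !inE mem_enum inE negbK.
Qed.

(** * The faces of a polytope with a rook graph *)

Section Grid.
Variables (p q : nat) (g1 : I -> 'I_p.+1) (g2 : I -> 'I_q.+1).
Hypothesis g_inj : injective (fun i => (g1 i, g2 i)).
Hypothesis cI : #|I| = (p.+1 * q.+1)%N.
Hypothesis adjE : forall i j, adj i j = (i != j) && ((g1 i == g1 j) || (g2 i == g2 j)).
Hypothesis dE : d = (p + q)%N.
Hypothesis p_gt0 : (0 < p)%N.
Hypothesis q_gt0 : (0 < q)%N.

Let g_surj := rook_surj g_inj cI.

Lemma grid_regular v : #|nb v| = d.
Proof. by rewrite dE; exact: rook_degree g_inj cI adjE v. Qed.

Lemma other_ord (m : nat) (a : 'I_m.+1) : (0 < m)%N -> exists b : 'I_m.+1, b != a.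
Proof.
case: m a => // m a _; have [->|a0] := eqVneq a ord0; first by exists ord_max.
by exists ord0; rewrite eq_sym.
Qed.

Lemma facial_col (b : 'I_q.+1) : facial x [set i | g2 i != b]%SET.
Proof.
have [b' bb'] := other_ord b q_gt0.
have [w [w1 w2]] := g_surj ord0 b; have [v [v1 v2]] := g_surj ord0 b'.
have vw : adj v w.
  rewrite adjE v1 w1 eqxx andbT; apply: contraNneq bb' => E; by rewrite -v2 E w2.
have [F [fF [vF wF nF oF]]] := simple_facet grid_regular vw.
have := fF; congr facial; apply/setP => u.
by rewrite (rook_facet g_inj g_surj adjE _ _ vF wF nF oF) ?inE ?v1 ?w1 ?w2 ?v2.
Qed.

Lemma facial_row (a : 'I_p.+1) : facial x [set i | g1 i != a]%SET.
Proof.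
have [a' aa'] := other_ord a p_gt0.
have [w [w1 w2]] := g_surj a ord0; have [v [v1 v2]] := g_surj a' ord0.
have vw : adj v w.
  rewrite adjE v2 w2 eqxx orbT andbT; apply: contraNneq aa' => E; by rewrite -v1 E w1.
have [F [fF [vF wF nF oF]]] := simple_facet grid_regular vw.
have := fF; congr facial; apply/setP => u.
have g_inj' : injective (fun i => (g2 i, g1 i)).
  by move=> i j [E2 E1]; apply: g_inj; rewrite E1 E2.
have g_surj' b c : exists i, g2 i = b /\ g1 i = c by have [i []] := g_surj c b; exists i.
have adjE' i j : adj i j = (i != j) && ((g2 i == g2 j) || (g1 i == g1 j)).
  by rewrite adjE orbC.
by rewrite (rook_facet g_inj' g_surj' adjE' _ _ vF wF nF oF) ?inE ?v1 ?w1 ?w2 ?v2.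
Qed.

Lemma facial_grid S : facial x S <-> grid_set g1 g2 S.
Proof.
split=> [[a [b [H HS]]]|[X [Y HS]]]; last first.
  have := facialI (facial_preim facial_row X) (facial_preim facial_col Y).
  by congr facial; apply/setP => i; rewrite !inE HS.
(* Write [x w - x v] over the edges at [v]. Among the neighbours of [v] only [k] is off the facet
   avoiding the column of [w], so its coefficient is nonzero; a functional maximal at both [v] and
   [w] is then maximal at [k]. *)
have corner v w k : v \in S -> w \in S -> g1 k = g1 v -> g2 k = g2 w -> k \in S.
  move=> vS wS k1 k2.
  have [g2vw|g2vw] := eqVneq (g2 v) (g2 w).
    by have -> : k = v by apply: g_inj; rewrite k1 k2 g2vw.
  have [a' [b' [H' HS']]] := facial_col (g2 w).
  have [c [c0 cN E]] := cone_nb exposed v w.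
  have av' : dotv a' (x v) = b' by apply/eqP; rewrite -HS' inE.
  have ck : c k != 0.
    apply/eqP => ck; have := congr1 (dotv a') E; rewrite dotvBr av' dotv_sumr big1 => [/eqP|l _].
      by rewrite subr_eq0 -HS' inE eqxx.
    have [vl|/cN->] := boolP (adj v l); last by rewrite scale0r dotv0r.
    have [lk|lk] := eqVneq l k; first by rewrite lk ck scale0r dotv0r.
    suff /eqP al : dotv a' (x l) == b' by rewrite dotvZr dotvBr al av' subrr mulr0.
    rewrite -HS' inE; apply: contraNneq lk => l2; apply/eqP/g_inj; rewrite k1 k2 l2.
    move: vl; rewrite adjE l2 (negPf g2vw) orbF => /andP[_ /eqP->] //.
  have /eqP av : dotv a (x v) == b by rewrite -HS.
  have /eqP aw : dotv a (x w) == b by rewrite -HS.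
  have : \sum_l c l * (b - dotv a (x l)) = 0.
    have := congr1 (dotv a) E; rewrite dotvBr av aw subrr dotv_sumr => E0.
    rewrite -[RHS]oppr0 [X in _ = - X]E0 -sumrN; apply: eq_bigr => l _.
    by rewrite dotvZr dotvBr av -mulrN opprB.
  move=> /eqP; rewrite psumr_eq0 => [/allP/(_ k (mem_index_enum _))|l _]; last first.
    by rewrite mulr_ge0 // subr_ge0.
  by rewrite mulf_eq0 (negPf ck) subr_eq0 eq_sym -HS.
exists [set g1 i | i in S]%SET, [set g2 i | i in S]%SET => i.
apply/idP/andP => [iS|[/imsetP[v vS Ev] /imsetP[w wS Ew]]]; first by rewrite !imset_f.
exact: corner Ev Ew.
Qed.

Lemma grid_comb_equiv : comb_equiv (hull x) (Delta R p q).
Proof.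
rewrite (Delta_hull R g_inj g_surj); apply: comb_equiv_facial => S.
by rewrite facial_grid (Delta_facial R g_surj).
Qed.

End Grid.
End Dimension.

(** * Summands and edges *)

Lemma convexb_hull (R : realType) (n : nat) (I : finType) (A : set 'rV[R]_n) (y : I -> 'rV[R]_n) :
  convexb A -> (forall i, A (y i)) -> hull y `<=` A.
Proof.
move=> cA yA z [w [w0 _ w1 ->]].
suff H (r : seq I) : 0 < \sum_(i <- r) w i ->
    A ((\sum_(i <- r) w i)^-1 *: \sum_(i <- r) w i *: y i).
  have := H (index_enum I); rewrite w1 ltr01 invr1 scale1r; exact.
elim: r => [|i r IH]; first by rewrite big_nil ltxx.
rewrite !big_cons; set c := \sum_(j <- r) w j in IH *; set v := \sum_(j <- r) _ in IH *.
have c0 : 0 <= c by apply: sumr_ge0.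
have [cz|cn] := eqVneq c 0.
  have -> : v = 0.
    apply: big1_seq => j /andP[_ jr]; move/eqP: cz; rewrite psumr_eq0 // => /allP/(_ j jr)/eqP->.
    exact: scale0r.
  rewrite cz !addr0 => wi; rewrite scalerA mulVf ?scale1r // gt_eqF //.
move=> wc; have cp : 0 < c by rewrite lt_neqAle eq_sym cn.
have wcn : w i + c != 0 by rewrite gt_eqF.
have t0 : 0 <= w i / (w i + c) by rewrite divr_ge0 // ltW.
have t1 : w i / (w i + c) <= 1 by rewrite ler_pdivrMr // mul1r lerDl.
have := cA (y i) (c^-1 *: v) (w i / (w i + c)) (yA i) (IH cp) t0 t1.
congr A; rewrite scalerDr !scalerA; congr (_ *: _ + _ *: _); first by rewrite mulrC.
by field; rewrite wcn.
Qed.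

Lemma hull_homothet (R : realType) (n : nat) (I : finType) (x : I -> 'rV[R]_n) (s : R) t :
  hull (fun i => s *: x i + t) = [set s *: p + t | p in hull x].
Proof.
have E (w : I -> R) : \sum_i w i = 1 ->
    \sum_i w i *: (s *: x i + t) = s *: (\sum_i w i *: x i) + t.
  move=> w1; rewrite -{2}[t]scale1r -w1 scaler_suml scaler_sumr -big_split.
  by apply: eq_bigr => i _; rewrite scalerDr !scalerA mulrC.
apply/seteqP; split => y /=.
  move=> [w [w0 wT w1 ->]]; exists (\sum_i w i *: x i); last by rewrite E.
  by exists w.
by move=> [_ [w [w0 wT w1 ->]] <-]; exists w; split => //; rewrite E.
Qed.

Section Summands.
Variables (R : realType) (n : nat) (I : finType) (x q r : I -> 'rV[R]_n) (Q Rb : set 'rV[R]_n).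
Hypothesis sumP : hull x = minkowski Q Rb.
Hypothesis qQ : forall i, Q (q i).
Hypothesis rR : forall i, Rb (r i).
Hypothesis xE : forall i, x i = q i + r i.

(** If [z] in [Q] were separated from all [q i] by [a], then at a vertex [v] maximal for [a] the
    point [z + r v] of the sum would exceed the maximum. *)
Lemma summand_hull (i0 : I) : convexb Q -> Q = hull q.
Proof.
move=> cQ; apply/seteqP; split; last exact: convexb_hull.
move=> z zQ; have [[a [_ Ha]]|[mu [nu [mu0 mu1 Emu]]]] :=
  motzkin xpredT xpred0 (fun i => z - q i) (fun i => 0); last first.
  exists mu; split => //; first by move=> i; rewrite inE.
  move: Emu; rewrite big_pred0_eq; under eq_bigr do rewrite scalerBr.
  by rewrite sumrB -scaler_suml mu1 scale1r => /eqP; rewrite subr_eq0 => /eqP.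
have [v _ vmax] := arg_maxP (fun i => dotv a (x i)) (isT : xpredT i0).
have le : dotv a (z + r v) <= dotv a (x v).
  apply: (hull_le (x := x)); first by move=> i; exact: vmax.
  by rewrite sumP; exists z, (r v).
have := Ha v isT; rewrite dotvBr; move: le; rewrite xE !dotvDr; lra.
Qed.

(** The points [q i + r j] and [q j + r i] have the same sum as [x i] and [x j], so both lie on the
    exposed edge. The height [s] is the weight of [x i] in the first of them. *)
Lemma adj_summand i j : vadj x i j -> exists s, lmeet x q s i j.
Proof.
move=> /vadjP[/eqP ij [a [E H]]].
have Hle k : dotv a (x k) <= dotv a (x i).
  have [->//|ki] := eqVneq k i; have [->|kj] := eqVneq k j; first by rewrite E.
  exact/ltW/H.
have HS k : (k \in [set i; j]%SET) = (dotv a (x k) == dotv a (x i)).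
  rewrite !inE; have [->|ki] := eqVneq k i; first by rewrite eqxx.
  have [->|kj] := eqVneq k j; first by rewrite E eqxx.
  by rewrite (lt_eqF (H k ki kj)).
have inP u v : hull x (q u + r v) by rewrite sumP; exists (q u), (r v).
have le1 := hull_le Hle (inP i j); have le2 := hull_le Hle (inP j i).
have : (hull x `&` [set y | dotv a y = dotv a (x i)]) (q i + r j).
  split; first exact: inP.
  by move: le1 le2 E; rewrite /= !xE !dotvDr; lra.
rewrite (hull_face Hle HS) => -[w [w0 wS w1 Ew]]; exists (w i).
have ji : j != i by rewrite eq_sym.
have sumE (V : zmodType) (F : I -> V) : (forall k, k != i -> k != j -> F k = 0) ->
    \sum_k F k = F i + F j.
  move=> F0; rewrite (bigD1 i) //= (bigD1 j) //= big1 ?addr0 // => k /andP[ki kj]; exact: F0.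
have wk k : k != i -> k != j -> w k = 0 by move=> ki kj; apply: wS; rewrite !inE negb_or ki.
rewrite sumE // in w1.
rewrite sumE in Ew; last by move=> k ki kj; rewrite wk // scale0r.
rewrite lmeetE; apply/eqP/rowP => l; move/rowP/(_ l): Ew; rewrite (_ : w j = 1 - w i); last by lra.
by rewrite !xE !mxE; lra.
Qed.

End Summands.

Lemma decomposition_meet (R : realType) (n : nat) (I : finType) (x : I -> 'rV[R]_n) (i0 : I) :
  decomposable (hull x) ->
  exists q : I -> 'rV[R]_n, (forall i j, vadj x i j -> exists s, lmeet x q s i j) /\
    ~ (exists s t, forall i, q i = s *: x i + t).
Proof.
move=> [Q [Rb [[_ [cQ _]] [[_ [cR _]] [sumP [nQ nR]]]]]].
have : forall i, exists qr : 'rV[R]_n * 'rV[R]_n, [/\ Q qr.1, Rb qr.2 & x i = qr.1 + qr.2].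
  by move=> i; have := hull_pt x i; rewrite sumP => -[a [b [aQ [bR E]]]]; exists (a, b).
move=> /choice[qr Hqr]; pose q i := (qr i).1; pose r i := (qr i).2.
have qQ i : Q (q i) by case: (Hqr i).
have rR i : Rb (r i) by case: (Hqr i).
have xE i : x i = q i + r i by case: (Hqr i).
exists q; split; first by move=> i j; apply: adj_summand sumP qQ rR xE _ _.
move=> [s [t Eq]].
have hom (A : set 'rV[R]_n) (y : I -> 'rV[R]_n) s' t' : 0 < s' -> A = hull y ->
    (forall i, y i = s' *: x i + t') -> homothet A (hull x).
  move=> s'0 -> Ey; exists s', t'; split => //; rewrite -hull_homothet; congr hull.
  exact/funext.
(* If [s] is not positive, the other summand takes over: [r i = (1 - s) *: x i - t] with
   [1 - s > 0]. *)
have [s0|s0] := ltP 0 s.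
  by apply: nQ; apply: hom s0 (summand_hull sumP qQ rR xE i0 cQ) Eq.
have sumP' : hull x = minkowski Rb Q.
  rewrite sumP; apply/seteqP; split => y [a [b [aA [bB ->]]]]; exists b, a;
  by split => //; split => //; rewrite addrC.
have xE' i : x i = r i + q i by rewrite addrC.
apply: nR; apply: (hom _ r (1 - s) (- t)); first by lra.
  exact: (summand_hull sumP' rR qQ xE' i0 cR).
by move=> i; apply/rowP => l; have /rowP/(_ l) := xE i; rewrite Eq !mxE; lra.
Qed.

Section Edges.
Variables (R : realType) (n : nat) (I : finType) (x : I -> 'rV[R]_n).
Hypothesis exposed : forall i, exists a, forall j, j != i -> dotv a (x j) < dotv a (x i).

Lemma vadj_facial i j : vadj x i j -> facial x [set i; j]%SET.
Proof.
move=> /vadjP[_ [a [E H]]]; exists a, (dotv a (x i)); split => k.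
  have [->//|ki] := eqVneq k i; have [->|kj] := eqVneq k j; first by rewrite E.
  exact/ltW/H.
rewrite !inE; have [->|ki] := eqVneq k i; first by rewrite eqxx.
have [->|kj] := eqVneq k j; first by rewrite E eqxx.
by rewrite (lt_eqF (H k ki kj)).
Qed.

Lemma vadj_edge i j : vadj x i j -> edge (hull x) (hull_on x [set i; j]%SET).
Proof.
move=> ij; split; first exact/facial_face/vadj_facial.
have neq : i != j by apply: contraTneq ij => ->; rewrite vadj_irr.
split.
  exists [:: x i; x j]; split => //; split.
    by move=> y; rewrite !inE => /orP[]/eqP->; apply: hull_on_pt; rewrite !inE eqxx ?orbT.
  move=> c /=; rewrite big_ord1 => /eqP; rewrite scaler_eq0 subr_eq0.
  rewrite (inj_eq (vertex_inj exposed)) [j == i]eq_sym (negPf neq) orbF => /eqP c0 k.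
  by rewrite (ord1 k).
move=> [|s0 t] //= sS indep; rewrite ltnS -[1%N]/(size [:: x j - x i]).
apply: aff_indep_span indep _ => y yt.
have inL z : hull_on x [set i; j]%SET z -> z - x i \in <<[:: x j - x i]>>%VS.
  set L := <<_>>%VS; move=> [w [w0 wS w1 ->]].
  rewrite -[x i]scale1r -w1 scaler_suml -sumrB.
  apply: rpred_sum => k _; rewrite -scalerBr.
  have [kS|/wS->] := boolP (k \in [set i; j]%SET); last by rewrite scale0r rpred0.
  apply: rpredZ; move: kS; rewrite !inE => /orP[]/eqP->; first by rewrite subrr rpred0.
  exact/memv_span/mem_head.
rewrite -(subrKA (x i)) -[x i - s0]opprB rpredB // inL //; apply: sS; rewrite inE ?eqxx //.
by rewrite yt orbT.
Qed.

Lemma degree_sum_le (N : nat) : at_most_edges (hull x) N ->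
  (\sum_v #|nb (vadj x) v| <= 2 * N)%N.
Proof.
move=> edges; pose rk (i : I) := val (enum_rank i).
have rk_inj : injective rk by move=> i j /val_inj/enum_rank_inj.
pose E := [set e : I * I | vadj x e.1 e.2 && (rk e.1 < rk e.2)%N]%SET.
pose f (e : 'I_#|E|) := hull_on x [set (enum_val e).1; (enum_val e).2]%SET.
have E_in (e : 'I_#|E|) : vadj x (enum_val e).1 (enum_val e).2 /\
    (rk (enum_val e).1 < rk (enum_val e).2)%N.
  by have := enum_valP e; rewrite inE => /andP[].
have f_inj : injective f.
  move=> e e' fE; apply: enum_val_inj.
  have [a1 lt1] := E_in e; have [a2 lt2] := E_in e'; move: fE; rewrite /f.
  case: (enum_val e) (enum_val e') a1 lt1 a2 lt2 => [i j] [k l] /= a1 lt1 a2 lt2 fE.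
  have EE : [set i; j]%SET = [set k; l]%SET.
    apply/setP => m; apply/idP/idP => mS.
      by apply: (facial_mem (vadj_facial a2)); rewrite -fE; exact: hull_on_pt.
    by apply: (facial_mem (vadj_facial a1)); rewrite fE; exact: hull_on_pt.
  have := set21 i j; have := set22 i j; have := set21 k l; rewrite -{1}EE EE !inE.
  move=> /orP[]/eqP Ek /orP[]/eqP Ej /orP[]/eqP Ei; subst => //; move: lt1 lt2; rewrite ?ltnn //.
  by move=> lt1 /(ltn_trans lt1); rewrite ltnn.
have := edges _ f f_inj (fun e => vadj_edge (E_in e).1).
move=> leN; apply: (@leq_trans (2 * #|E|)); last by rewrite leq_mul2l.
have cE : #|E| = (\sum_i \sum_j (vadj x i j && (rk i < rk j)))%N.
  rewrite pair_bigA /= -sum1_card big_mkcond; apply: eq_bigr => e _.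
  by rewrite inE; case: (_ && _).
rewrite mul2n -addnn {2}cE exchange_big cE -big_split leq_eqVlt; apply/orP; left; apply/eqP.
apply: eq_bigr => i _; rewrite -big_split -sum1_card big_mkcond; apply: eq_bigr => j _ /=.
rewrite inE [vadj x j i]vadjC; have [ij|//] := boolP (vadj x i j).
have : rk i != rk j by apply: contraTneq ij => /rk_inj->; rewrite vadj_irr.
by case: ltngtP.
Qed.

End Edges.

Lemma polytope_vertices (R : realType) (n : nat) (P : set 'rV[R]_n) : polytope P ->
  exists (m : nat) (x : 'I_m -> 'rV[R]_n), P = hull x /\
    forall i, exists a, forall j, j != i -> dotv a (x j) < dotv a (x i).
Proof.
move=> [s [_ Ps]].
have ex : exists m, `[< exists x : 'I_m -> 'rV[R]_n, P = hull x >].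
  by exists (size s); apply/asboolP; exists (fun i => s`_i); rewrite -conv_hull.
case: (ex_minnP ex) => m /asboolP[x Px] mmin; exists m, x; split => // i.
case: m i x Px mmin => [[]//|m] i x Px mmin.
have [[a [_ Ha]]|[mu [nu [mu0 mu1 Emu]]]] :=
  motzkin xpredT xpred0 (fun k : 'I_m => x i - x (lift i k)) (fun k => 0).
  exists a => j ji; have [k ->|E] := unliftP i j; last by rewrite E eqxx in ji.
  by have := Ha k isT; rewrite dotvBr subr_gt0.
have Ei : x i = \sum_k mu k *: x (lift i k).
  move: Emu; rewrite big_pred0_eq; under eq_bigr do rewrite scalerBr.
  by rewrite sumrB -scaler_suml mu1 scale1r => /eqP; rewrite subr_eq0 => /eqP.
suff /mmin : `[< exists x : 'I_m -> 'rV[R]_n, P = hull x >] by rewrite ltnn.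
apply/asboolP; exists (fun k => x (lift i k)); rewrite Px; apply/seteqP; split => y.
  move=> [w [w0 _ w1 ->]]; exists (fun k => w (lift i k) + w i * mu k); split.
  - by move=> k; rewrite addr_ge0 // mulr_ge0.
  - by move=> k; rewrite inE.
  - by rewrite big_split /= -mulr_sumr mu1 mulr1 -w1 (bigD1_ord i) //= addrC.
  rewrite (bigD1_ord i) //= Ei scaler_sumr -big_split; apply: eq_bigr => k _ /=.
  by rewrite scalerDl scalerA addrC.
apply: convexb_hull => [u v t [w [w0 _ w1 ->]] [w' [w'0 _ w'1 ->]] t0 t1|k]; last exact: hull_pt.
exists (fun j => t * w j + (1 - t) * w' j); split.
- by move=> j; rewrite addr_ge0 // mulr_ge0 // subr_ge0.
- by move=> j; rewrite inE.
- by rewrite big_split /= -!mulr_sumr w1 w'1 !mulr1 addrC subrK.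
rewrite !scaler_sumr -big_split; apply: eq_bigr => j _ /=.
by rewrite [RHS]scalerDl !scalerA.
Qed.

(** If at every vertex all neighbours met it at the same height, this height would propagate along
    the connected graph and make all lines concurrent. *)
Lemma two_meeting_points (R : realType) (n : nat) (I : finType) (x q : I -> 'rV[R]_n) (i0 u0 : I) :
  (forall i, exists a, forall j, j != i -> dotv a (x j) < dotv a (x i)) -> vadj x i0 u0 ->
  (forall i j, vadj x i j -> exists s, lmeet x q s i j) ->
  ~ (exists s t, forall i, q i = s *: x i + t) ->
  exists v u w s, [/\ vadj x v u, vadj x v w, lmeet x q s v u & ~~ lmeet x q s v w].
Proof.
move=> exposed adj0 adj_meet nconc; apply: contrapT => none; apply: nconc.
have [s m0] := adj_meet _ _ adj0.
have same v u w t : vadj x v u -> vadj x v w -> lmeet x q t v u -> lmeet x q t v w.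
  by move=> vu vw mvu; apply: contraT => nvw; case: none; exists v, u, w, t.
pose S k := lmeet x q s i0 k && [forall l, vadj x k l ==> lmeet x q s k l].
have S0 : S i0.
  rewrite /S lmeet_refl; apply/forallP => l; apply/implyP => i0l; exact: same adj0 i0l m0.
have clos i j : S i -> vadj x i j -> S j.
  move=> /andP[mi /forallP H] ij; have mij := implyP (H j) ij.
  rewrite /S (lmeet_trans mi mij); apply/forallP => l; apply/implyP => jl.
  by apply: same jl _; [rewrite vadjC; exact: ij | rewrite lmeetC].
exists s, (q i0 - s *: x i0) => i.
have /andP[/eqP-> _] := vadj_connected exposed S0 clos i.
by rewrite addrC subrK.
Qed.

Theorem theorem11 (R : realType) (n d : nat) (P : set 'rV[R]_n) :
  (3 <= d)%N ->
  polytope P -> has_dim P d -> decomposable P ->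
  at_most_edges P ((2 * d ^ 2 + d) %/ 2)%N ->
  comb_equiv P (Delta R 1 (d - 1)) \/ (d = 4%N /\ comb_equiv P (Delta R 2 2)).
Proof.
move=> d3 /polytope_vertices[m [x [-> exposed]]] [dimP _] decP edges.
have deg_ge v : (d <= #|nb (vadj x) v|)%N := degree_ge exposed dimP v.
have [i0 _] : exists i0 : 'I_m, True.
  have [[|y s] [// [_ [sP _]]]] := dimP; have [w [_ _ w1 _]] := sP y (mem_head y s).
  case: m {deg_ge edges decP exposed dimP sP} x w w1 => [x w /eqP|m x w _]; last by exists ord0.
  by rewrite big_ord0 eq_sym oner_eq0.
have [u0 adj0] : exists u0, vadj x i0 u0.
  have /card_gt0P[u0] : (0 < #|nb (vadj x) i0|)%N by apply: leq_trans (deg_ge i0); lia.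
  by rewrite inE; exists u0.
have [q [adj_meet nconc]] := decomposition_meet i0 decP.
have sum_le := degree_sum_le exposed edges.
have sum_ge : (d * m <= \sum_v #|nb (vadj x) v|)%N.
  by rewrite mulnC -{1}(card_ord m) -sum_nat_const; exact: leq_sum.
have le1 : (2 * ((2 * d ^ 2 + d) %/ 2) <= 2 * d ^ 2 + d)%N by rewrite mulnC leq_trunc_div.
have m_le : (m <= 2 * d + 1)%N by nia.
have := @adj_is_rook R 'I_m (vadj x) (lmeet x q) d (vadjC x) (vadj_irr x)
  (lmeet_refl x q) (lmeetC x q) (lmeet_trans (x := x) (q := q)) (lmeet_uniq exposed (q := q))
  adj_meet (lmeet_triangle exposed (q := q)) d3 deg_ge (common_nb_le exposed dimP adj_meet).
case.
- move=> reg v w /(simple_facet exposed dimP reg)[F [_ HF]]; by exists F.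
- by rewrite card_ord.
- rewrite card_ord => Em v; apply/eqP; rewrite eqn_leq deg_ge andbT.
  have : (\sum_(u | u != v) d <= \sum_(u | u != v) #|nb (vadj x) u|)%N by exact: leq_sum.
  have : (\sum_(u : 'I_m) d = d + \sum_(u | u != v) d)%N by rewrite (bigD1 v).
  rewrite [LHS]sum_nat_const [in LHS]card_ord [LHS]mulnC => sd sr.
  have dm : (d * m = 2 * d ^ 2 + d)%N by rewrite Em mulnDr muln1 mulnCA.
  move: sum_le; rewrite (bigD1 v) //= => sum_le'.
  rewrite -(leq_add2r (\sum_(u | u != v) #|nb (vadj x) u|)) (leq_trans sum_le') //.
  by rewrite (leq_trans le1) // -dm sd leq_add2l.
(* At most 10 edges, so the degree sum is at most 20, while seven vertices of degree at least 3 need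
   21. *)
- move=> E3; rewrite card_ord; move: sum_le sum_ge; rewrite E3 => h1 h2.
  by have := leq_trans h2 h1; lia.
- exact: two_meeting_points exposed adj0 adj_meet nconc.
- move=> [g1 [g2 [ginj cI adjE]]]; left.
  by apply: (grid_comb_equiv exposed dimP ginj cI adjE) => //; lia.
move=> [d4 [g1 [g2 [ginj cI adjE]]]]; right; split => //.
by apply: (grid_comb_equiv exposed dimP ginj cI adjE).
Qed.
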